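(* Let $\mu\in\mathbb R$, $\sigma^2>0$, let $X_1,X_2,\dots$ be i.i.d. $\mathcal N(\mu,\sigma^2)$, fix $T\in(0,\infty)$, $M\in\mathbb N$, $\beta>0$, and let $w(t)=\exp(-\beta t^2)$. With $\Delta_m^{(n)}$ and $Q_m$ as in the context, $$n\big(\Delta_1^{(n)},\dots,\Delta_M^{(n)}\big)\xrightarrow{d}(Q_1,\dots,Q_M)\qquad(n\to\infty).$$
   Context: For a sample $X_1,\dots,X_n$: $\bar X=\frac1n\sum_k X_k$, $S_X^2=\frac1n\sum_k(X_k-\bar X)^2$, $\widehat\psi_X(t)=\frac1n\sum_k e^{itX_k}$, $\widehat\psi_X^*(t)=\exp(-it\bar X/S_X)\,\widehat\psi_X(t/S_X)$, $\psi_0(t)=e^{-t^2/2}$, $\psi(t)=\exp(i\mu t-\sigma^2t^2/2)$. For $m\in\mathbb N$: $S_m^{(n)}(t)=(\widehat\psi_X^*(t/\sqrt m))^m$, $D_m^{(n)}=S_{m+1}^{(n)}-S_m^{(n)}$, $\Delta_m^{(n)}=\int_{-T}^T w(t)|D_m^{(n)}(t)|^2dt$. Let $(G,Y_1,Y_2)$ be the joint weak limit in $C([-T/\sigma,T/\sigma];\mathbb C)\times\mathbb R^2$ of $\big(\sqrt n(\widehat\psi_X-\psi),\sqrt n(\bar X-\mu),\sqrt n(S_X-\sigma)\big)$ ($G$ is a centered complex Gaussian process with $\mathrm{Cov}(G(s),\overline{G(t)})=\psi(s-t)-\psi(s)\psi(-t)$, and $Y_1,Y_2$ are uncorrelated centered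 normals with variances $\sigma^2$ and $\sigma^2/2$). Define $G_0(t)=\exp(-it\mu/\sigma)G(t/\sigma)-\frac{it}{\sigma}\psi_0(t)Y_1+\frac{t^2}{\sigma}\psi_0(t)Y_2$ for $t\in[-T,T]$, $$H_m(t)=(m+1)\frac{G_0(t/\sqrt{m+1})}{\psi_0(t/\sqrt{m+1})}-m\frac{G_0(t/\sqrt m)}{\psi_0(t/\sqrt m)},\qquad Q_m=\int_{-T}^T w(t)\psi_0(t)^2|H_m(t)|^2dt.$$ *)

(* Defs.v *)
From HB Require Import structures.
From mathcomp Require Import all_boot all_order all_algebra.
From mathcomp Require Import all_classical all_reals all_analysis.
From mathcomp Require Import complex.
Set Implicit Arguments. Unset Strict Implicit. Unset Printing Implicit Defensive.
Import Order.TTheory GRing.Theory Num.Theory.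
Local Open Scope classical_set_scope.
Local Open Scope ring_scope.

Section defs.
Variable R : realType.

Definition cis (th : R) : R[i] := (cos th +i* sin th)%C.

Definition normsq (z : R[i]) : R := complex.Re z ^+ 2 + complex.Im z ^+ 2.

Definition RtoC (x : R) : R[i] := (x +i* 0)%C.

Definition smean (n : nat) (x : nat -> R) : R :=
  (n%:R)^-1 * \sum_(k < n) x k.

Definition ssdev (n : nat) (x : nat -> R) : R :=
  Num.sqrt ((n%:R)^-1 * \sum_(k < n) (x k - smean n x) ^+ 2).

Definition ecf (n : nat) (x : nat -> R) (t : R) : R[i] :=
  (n%:R)^-1 * \sum_(k < n) cis (t * x k).

Definition secf (n : nat) (x : nat -> R) (t : R) : R[i] :=
  cis (- (t * smean n x / ssdev n x)) * ecf n x (t / ssdev n x).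

Definition Sm (n : nat) (x : nat -> R) (m : nat) (t : R) : R[i] :=
  secf n x (t / Num.sqrt (m%:R)) ^+ m.

Definition Dm (n : nat) (x : nat -> R) (m : nat) (t : R) : R[i] :=
  Sm n x m.+1 t - Sm n x m t.

Definition Delta (w : R -> R) (T : R) (n : nat) (x : nat -> R) (m : nat) : R :=
  (\int[lebesgue_measure]_(t in `[- T, T]) (w t * normsq (Dm n x m t)))%R.

Definition psi0 (t : R) : R := expR (- (t ^+ 2 / 2)).

Definition psi (mu sigma : R) (t : R) : R[i] :=
  RtoC (expR (- (sigma ^+ 2 * t ^+ 2 / 2))) * cis (mu * t).

Definition G0 (mu sigma : R) (G : R -> R[i]) (Y1 Y2 : R) (t : R) : R[i] :=
  cis (- (t * mu / sigma)) * G (t / sigma)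
  - (0 +i* 1)%C * RtoC (t / sigma * psi0 t * Y1)
  + RtoC (t ^+ 2 / sigma * psi0 t * Y2).

Definition Hm (mu sigma : R) (G : R -> R[i]) (Y1 Y2 : R) (m : nat) (t : R)
  : R[i] :=
  (m.+1)%:R * (G0 mu sigma G Y1 Y2 (t / Num.sqrt (m.+1)%:R)
                 / RtoC (psi0 (t / Num.sqrt (m.+1)%:R)))
  - m%:R * (G0 mu sigma G Y1 Y2 (t / Num.sqrt m%:R)
                 / RtoC (psi0 (t / Num.sqrt m%:R))).

Definition Qm (w : R -> R) (T mu sigma : R) (G : R -> R[i]) (Y1 Y2 : R)
  (m : nat) : R :=
  (\int[lebesgue_measure]_(t in `[- T, T])
     (w t * psi0 t ^+ 2 * normsq (Hm mu sigma G Y1 Y2 m t)))%R.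

Definition contC_on (a : R) (g : R -> R[i]) : Prop :=
  forall s, - a <= s <= a -> forall e : R, 0 < e -> exists2 d : R, 0 < d &
    forall s', - a <= s' <= a -> `|s' - s| < d -> Num.sqrt (normsq (g s' - g s)) < e.

(* Bounded functionals on (functions R -> C) x R x R that are continuous for
   the sup-norm on [-a, a] in the first component (product topology of
   C([-a,a];C) x R^2). *)
Definition bdd_cont_functional (a : R) (F : (R -> R[i]) -> R -> R -> R) : Prop :=
  (exists C : R, forall g y1 y2, `|F g y1 y2| <= C) /\
  (forall g y1 y2 (e : R), 0 < e -> exists2 d : R, 0 < d &
     forall g' y1' y2',
       (forall s, - a <= s <= a -> Num.sqrt (normsq (g' s - g s)) < d) ->
       `|y1' - y1| < d -> `|y2' - y2| < d ->
       `|F g' y1' y2' - F g y1 y2| < e).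

Definition mutually_independent d (T : measurableType d)
  (P : probability T R) (X : nat -> T -> R) : Prop :=
  forall (s : seq nat) (B : nat -> set R), uniq s ->
    (forall k, measurable (B k)) ->
    P (\bigcap_(k in [set k | k \in s]) (X k @^-1` B k)) =
    (\prod_(k <- s) P (X k @^-1` B k))%E.

End defs.

(* Main.v *)
Require Import Defs.
From HB Require Import structures.
From mathcomp Require Import all_boot all_order all_algebra.
From mathcomp Require Import all_classical all_reals all_analysis.
From mathcomp Require Import complex.
From mathcomp Require Import measurable_realfun ring lra.
Import Order.TTheory GRing.Theory Num.Theory.
Import numFieldTopology.Exports numFieldNormedType.Exports.
Import Normc.
Local Open Scope classical_set_scope.
Local Open Scope ring_scope.

(* Put h = n^-1/2, and let Z, U, V be the rescaled errors of the empirical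
   characteristic function, the mean and the standard deviation. The map sending
   (g, y1, y2) to f(Q_1, ..., Q_M) is itself a bounded continuous functional, so
   its expectations at (Z, U, V) converge to the right-hand side, and it remains
   to compare n Delta_m with Q_m(Z, U, V) pathwise. When U, V and Z are bounded
   by K and Z oscillates by at most eta at scale delta >> h, a first order
   expansion gives |n Delta_m - Q_m| <= C (h + eta). Two points need care.
   Z(t / S) - Z(t / sigma) is controlled by the oscillation of Z only while
   t / S stays in [-T/sigma, T/sigma]; outside, the Lipschitz constant sqrt(n) L
   of Z still gives O(1), on a set of t of measure O(h). That such K, eta and
   delta exist with high probability follows from the assumed convergence,
   applied to a functional measuring size and oscillation, since the limit G has
   continuous paths. *)

(** * Complex modulus and Taylor estimates *)

(** The factor n is the right one because the Gaussian is stable: [psi0 (t / sqrt m) ^ m = psi0 t]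
    for m >= 1, so every [Sm] is close to the same function, [Dm] is of order h, and n |[Dm]|^2 is
    of order one. The quotients by [psi0] in [Hm] and the factor [psi0 ^ 2] in [Qm] are what the
    derivative of z^m at [psi0 (t / sqrt m)] leaves. Two features shape the rest. Test functionals
    are defined on all functions g, so [Qm] has to be continuous even at paths for which its
    integrand is not measurable or its integral is infinite. And no probability of a bad event is
    ever estimated: the functional that measures size and oscillation reaches 1 wherever the path is
    not controlled, so it enters a pointwise bound that is then integrated. *)

Section complex_modulus.
Variable R : realType.
Implicit Types (x y a b : R) (z : R[i]).

Lemma sqrt_normsq z : Num.sqrt (normsq z) = normc z.
Proof. by case: z. Qed.

Lemma normc_ge0 z : 0 <= normc z.
Proof. by rewrite -sqrt_normsq sqrtr_ge0. Qed.

Lemma normsqE z : normsq z = normc z ^+ 2.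
Proof. by rewrite -sqrt_normsq sqr_sqrtr// addr_ge0 ?sqr_ge0. Qed.

Lemma normsq_ge0 z : 0 <= normsq z.
Proof. by rewrite normsqE sqr_ge0. Qed.

Lemma normc_RtoC x : normc (RtoC x) = `|x|.
Proof. by rewrite /= expr0n addr0 sqrtr_sqr. Qed.

Lemma normcX z n : normc (z ^+ n) = normc z ^+ n.
Proof. by elim: n => [|n IH]; rewrite ?normc1// !exprS normcM IH. Qed.

Lemma normc_i : normc (0 +i* 1)%C = 1 :> R.
Proof. by rewrite /= expr0n expr1n add0r sqrtr1. Qed.

Lemma normc_natr n : normc (n%:R : R[i]) = n%:R.
Proof. by rewrite -[n%:R]/(1 *+ n) normcMn normc1. Qed.

Lemma le_normcB z1 z2 : normc (z1 - z2) <= normc z1 + normc z2.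
Proof. by rewrite (le_trans (le_normcD _ _))// normcN. Qed.

Lemma normcBC z1 z2 : normc (z1 - z2) = normc (z2 - z1).
Proof. by rewrite -normcN opprB. Qed.

Lemma le_normc_dist z1 z2 : normc z1 <= normc z2 + normc (z1 - z2).
Proof. by rewrite -{1}(subrK z2 z1) addrC; exact: le_normcD. Qed.

Lemma le_normc_trans z1 z2 z3 :
  normc (z1 - z3) <= normc (z1 - z2) + normc (z2 - z3).
Proof.
rewrite (_ : z1 - z3 = (z1 - z2) + (z2 - z3)); first exact: le_normcD.
by rewrite addrA subrK.
Qed.

Lemma le_normc_sum (I : Type) (r : seq I) (F : I -> R[i]) :
  normc (\sum_(i <- r) F i) <= \sum_(i <- r) normc (F i).
Proof.
elim/big_ind2 : _ => //; first by rewrite normc0.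
by move=> x1 x2 y1 y2 h1 h2; rewrite (le_trans (le_normcD _ _))// lerD.
Qed.

Lemma le_normc_ReIm z : normc z <= `|complex.Re z| + `|complex.Im z|.
Proof.
case: z => x y /=; rewrite -[leRHS]ger0_norm ?addr_ge0// -sqrtr_sqr.
rewrite ler_wsqrtr// sqrrD !real_normK ?num_real// lerD2r lerDl.
by rewrite mulrn_wge0 ?mulr_ge0.
Qed.

Lemma RtoCM x y : RtoC (x * y) = RtoC x * RtoC y.
Proof. exact: (rmorphM (real_complex R)). Qed.

Lemma RtoCD x y : RtoC (x + y) = RtoC x + RtoC y.
Proof. exact: (rmorphD (real_complex R)). Qed.

Lemma RtoCB x y : RtoC (x - y) = RtoC x - RtoC y.
Proof. exact: (rmorphB (real_complex R)). Qed.

Lemma RtoCN x : RtoC (- x) = - RtoC x.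
Proof. exact: (rmorphN (real_complex R)). Qed.

Lemma RtoCV x : RtoC x^-1 = (RtoC x)^-1.
Proof. exact: (fmorphV (real_complex R)). Qed.

Lemma RtoCX x n : RtoC (x ^+ n) = RtoC x ^+ n.
Proof. exact: (rmorphXn (real_complex R)). Qed.

Lemma RtoC_nat n : RtoC n%:R = n%:R :> R[i].
Proof. exact: (rmorph_nat (real_complex R)). Qed.

Lemma RtoC1 : RtoC 1 = 1 :> R[i].
Proof. by []. Qed.

Lemma RtoC_eq0 x : (RtoC x == 0) = (x == 0).
Proof. by rewrite eq_complex /= eqxx andbT. Qed.

Lemma cisD x y : cis (x + y) = cis x * cis y.
Proof.
rewrite /cis cosD sinD; apply/eqP; rewrite eq_complex /= eqxx/=.
by rewrite addrC.
Qed.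

Lemma normc_cis x : normc (cis x) = 1.
Proof. by rewrite /= cos2Dsin2 sqrtr1. Qed.

(** The endpoints are not ordered, so the estimates below hold for increments of either sign. *)
Lemma mean_value (f df : R -> R) : (forall x, is_derive x 1 f (df x)) ->
  forall a b, exists2 c,
    Num.min a b <= c <= Num.max a b & f b - f a = df c * (b - a).
Proof.
move=> fdf a b.
have fc : continuous f.
  by move=> x; apply/differentiable_continuous/derivable1_diffP; have [] := fdf x.
have [ab|/ltW ba] := leP a b.
  have [c cab E] := MVT_segment ab (fun x _ => fdf x) (continuous_subspaceT fc).
  by exists c => //; move: cab; rewrite in_itv.
have [c cab E] := MVT_segment ba (fun x _ => fdf x) (continuous_subspaceT fc).
exists c; first by move: cab; rewrite in_itv.
by rewrite -opprB E -mulrN opprB.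
Qed.

Lemma mean_value0 (f df : R -> R) : (forall x, is_derive x 1 f (df x)) ->
  forall b, exists2 c, `|c| <= `|b| & f b - f 0 = df c * b.
Proof.
move=> fdf b; have [c cb E] := mean_value _ _ fdf 0 b.
exists c; last by rewrite E subr0.
move: cb; rewrite !ler_norml ge_min le_max.
case: (ger0P b) => b0 /andP[/orP[]h1 /orP[]h2]; apply/andP; split; lra.
Qed.

Lemma le_norm_sin x : `|sin x| <= `|x|.
Proof.
have [c _] := mean_value0 sin cos (fun x => is_derive_sin x) x.
rewrite sin0 subr0 => ->; rewrite normrM ler_piMl//.
by rewrite ler_norml cos_geN1 cos_le1.
Qed.

Lemma norm_cosB1_le x : `|cos x - 1| <= `|x|.
Proof.
have [c _] := mean_value0 cos (fun x => - sin x) (fun x => is_derive_cos x) x.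
rewrite cos0 => ->; rewrite normrM ler_piMl// normrN.
by rewrite ler_norml sin_geN1 sin_le1.
Qed.

Lemma norm_cosB1_le_sqr x : `|cos x - 1| <= x ^+ 2.
Proof.
have [c cx] := mean_value0 cos (fun x => - sin x) (fun x => is_derive_cos x) x.
rewrite cos0 => ->; rewrite normrM normrN -[leRHS]real_normK ?num_real// expr2.
by rewrite ler_wpM2r// (le_trans (le_norm_sin _)).
Qed.

Lemma norm_sinBid_le_sqr x : `|sin x - x| <= x ^+ 2.
Proof.
have [c cx] := mean_value0 (fun y => sin y - y) (fun x => cos x - 1)
  (fun x => is_deriveB (is_derive_sin x) (is_derive_id x 1)) x.
rewrite sin0 !subr0 => ->; rewrite normrM -[leRHS]real_normK ?num_real// expr2.
by rewrite ler_wpM2r// (le_trans (norm_cosB1_le _)).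
Qed.

Lemma cis_taylor1 x : normc (cis x - 1 - (0 +i* 1)%C * RtoC x) <= 2 * x ^+ 2.
Proof.
apply: (le_trans (le_normc_ReIm _)); rewrite /= !(mul0r, mulr0, mul1r, subr0, oppr0, add0r, addr0).
by have := norm_cosB1_le_sqr x; have := norm_sinBid_le_sqr x; lra.
Qed.

Lemma cis_lipschitz x y : normc (cis x - cis y) <= 2 * `|x - y|.
Proof.
have -> : cis x - cis y = cis y * (cis (x - y) - 1).
  by rewrite mulrBr mulr1 -cisD subrKC.
rewrite normcM normc_cis mul1r (le_trans (le_normc_ReIm _))//= subr0.
by have := norm_cosB1_le (x - y); have := le_norm_sin (x - y); lra.
Qed.

Lemma expRN_lipschitz a b : 0 <= a -> 0 <= b ->
  `|expR (- b) - expR (- a)| <= `|b - a|.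
Proof.
move=> a0 b0; have [|c /andP[ca _] E] := mean_value (fun x => expR (- x)) (fun x => - expR (- x)) _ a b.
  by move=> x; apply: trigger_derive; rewrite /GRing.scale /= ; ring.
rewrite E normrM normrN ler_piMl// ger0_norm ?expR_ge0// expR_le1 oppr_le0.
by rewrite (le_trans _ ca)// le_min a0.
Qed.

Lemma expRN_taylor1 a b : 0 <= a -> 0 <= b ->
  `|expR (- b) - expR (- a) + expR (- a) * (b - a)| <= (b - a) ^+ 2.
Proof.
move=> a0 b0; have [|c cab E] := mean_value (fun x => expR (- x)) (fun x => - expR (- x)) _ a b.
  by move=> x; apply: trigger_derive; rewrite /GRing.scale /= ; ring.
have c0 : 0 <= c by case/andP: cab => + _; apply: le_trans; rewrite le_min a0.
rewrite E -mulrDl normrM -[leRHS]real_normK ?num_real// expr2 ler_wpM2r//.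
rewrite addrC (le_trans (expRN_lipschitz _ _ c0 a0))//.
case/andP: cab; rewrite ge_min le_max => /orP[]h1 /orP[]h2;
  rewrite ler_norml; case: (ger0P (b - a)) => h3; apply/andP; split; lra.
Qed.

End complex_modulus.

(** * First order expansions *)

Section linearization.
Variable R : realType.
Implicit Types (m n : nat) (h u U V K T : R).

(** Keeps the perturbed standard deviation away from 0, which makes dividing by it harmless. *)
Lemma near_sigma sigma K h V : 0 < sigma -> 0 <= h -> h * K <= sigma / 2 ->
  `|V| <= K -> sigma / 2 <= sigma + h * V.
Proof.
move=> s0 h0 hK VK; have : - (h * K) <= h * V.
  by rewrite -mulrN ler_wpM2l// (le_trans _ (lerNnormlW VK))// lerN2.
lra.
Qed.

Lemma div_sdev_dist sigma K T h V u : 0 < sigma -> 0 <= h ->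
  h * K <= sigma / 2 -> `|V| <= K -> `|u| <= T ->
  `|u / (sigma + h * V) - u / sigma| <= 2 * T * K / sigma ^+ 2 * h.
Proof.
move=> s0 h0 hK VK uT; have q0 := near_sigma _ _ _ _ s0 h0 hK VK.
set q := sigma + h * V in q0 *; have qp : 0 < q by apply: lt_le_trans q0; lra.
have -> : u / q - u / sigma = - (h * (V * (u * (q^-1 * sigma^-1)))).
  by rewrite /q; field; rewrite -/q !gt_eqF.
rewrite normrN normrM (ger0_norm h0) mulrC ler_wpM2r//.
have -> : 2 * T * K / sigma ^+ 2 = K * (T * (2 / sigma * sigma^-1)).
  by field; rewrite -?/q ?gt_eqF.
have T0 : 0 <= T := le_trans (normr_ge0 _) uT.
have si : 0 <= sigma^-1 by rewrite invr_ge0 ltW.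
rewrite !normrM ler_pM ?mulr_ge0// ler_pM ?mulr_ge0//.
rewrite (ger0_norm si) ler_wpM2r// ger0_norm ?invr_ge0 ?(ltW qp)//.
by rewrite -[2 / sigma]invf_div lef_pV2 ?posrE//; lra.
Qed.

Lemma norm_div_sdev sigma K T h V u : 0 < sigma -> 0 <= h ->
  h * K <= sigma / 2 -> `|V| <= K -> `|u| <= T ->
  `|u / (sigma + h * V)| <= 2 * T / sigma.
Proof.
move=> s0 h0 hK VK uT; have q0 := near_sigma _ _ _ _ s0 h0 hK VK.
have qp : 0 < sigma + h * V by apply: lt_le_trans q0; lra.
rewrite normrM (_ : 2 * T / sigma = T * (2 / sigma)); last by ring.
apply: ler_pM => //; rewrite ger0_norm ?invr_ge0 ?(ltW qp)//.
by rewrite -[2 / sigma]invf_div lef_pV2 ?posrE//; lra.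
Qed.

(** The part of [G0] that does not involve the process: the derivative at h = 0 of the Gaussian
    characteristic function standardized with mean mu + h U and standard deviation sigma + h V. *)
Definition G0_drift sigma U V u : R[i] :=
  - (0 +i* 1)%C * RtoC (u / sigma * psi0 u * U)
  + RtoC (u ^+ 2 / sigma * psi0 u * V).

Lemma psi0_ge0 u : 0 <= psi0 u. Proof. exact: expR_ge0. Qed.

Lemma psi0_gt0 u : 0 < psi0 u. Proof. exact: expR_gt0. Qed.

Lemma psi0_le1 u : psi0 u <= 1.
Proof. by rewrite expR_le1 oppr_le0 divr_ge0 ?sqr_ge0. Qed.

Lemma cf_linearization (mu sigma T K : R) : 0 < sigma -> 0 <= T -> 0 <= K ->
  exists2 C, 0 <= C & forall h U V u, 0 <= h ->
    h * K <= sigma / 2 -> `|U| <= K -> `|V| <= K -> `|u| <= T ->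
    normc (cis (- (u * (mu + h * U) / (sigma + h * V)))
        * psi mu sigma (u / (sigma + h * V))
      - RtoC (psi0 u) - RtoC h * G0_drift sigma U V u) <= C * h ^+ 2.
Proof.
move=> s0 T0 K0.
pose D := 2 * T * K / sigma ^+ 2; pose X := 2 * T / sigma.
pose A := X * K; pose B := sigma / 2 * K * (X * (X + X)).
have sl : 0 <= sigma by exact: ltW.
have D0 : 0 <= D by rewrite !mulr_ge0 ?invr_ge0 ?sqr_ge0.
have X0 : 0 <= X by rewrite !mulr_ge0 ?invr_ge0.
have A0 : 0 <= A by rewrite mulr_ge0.
have B0 : 0 <= B by rewrite /B; clearbody X; rewrite !mulr_ge0 ?addr_ge0.
(* One summand for each error term of the decomposition below: second order in the phase, second
   order in the exponent, their cross term, [al] replaced by [al0], [be] replaced by [be0]. *)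
exists (2 * A ^+ 2 + B ^+ 2 + A * B + D * K + sigma / 2 * K * (D * (X + 2 * X))).
  by clearbody X A B D; rewrite !addr_ge0 ?mulr_ge0 ?addr_ge0 ?sqr_ge0 ?mulr_ge0.
move=> h U V u h0 hK UK VK uT; set q := sigma + h * V.
have q0 := near_sigma _ _ _ _ s0 h0 hK VK; rewrite -/q in q0.
have qp : 0 < q by apply: lt_le_trans q0; lra.
have [x xE] : exists x, x = u / q by exists (u / q).
have [x0 x0E] : exists x0, x0 = u / sigma by exists (u / sigma).
have xX : `|x| <= X by rewrite xE (norm_div_sdev sigma K).
have xx0 : `|x - x0| <= D * h by rewrite xE x0E div_sdev_dist.
have x0X : `|x0| <= X.
  rewrite x0E /X normrM [`|sigma^-1|]ger0_norm ?invr_ge0 ?(ltW s0)// ler_wpM2r ?invr_ge0 ?(ltW s0)//.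
  by rewrite (le_trans uT)//; lra.
(* The phase is exactly -h [al], and sigma^2 x^2 / 2 exceeds u^2 / 2 by exactly h [be]; [al0] and
   [be0] are the values of [al] and [be] at h = 0. *)
pose al := x * U; pose al0 := x0 * U.
pose be := - (sigma / 2 * V * (x * (x + x0))).
pose be0 := - (sigma * V * x0 ^+ 2).
pose p := psi0 u; pose e := expR (- (sigma ^+ 2 * x ^+ 2 / 2)).
have bE : sigma ^+ 2 * x ^+ 2 / 2 - u ^+ 2 / 2 = h * be.
  by rewrite /be xE x0E /q; field; rewrite -/q !gt_eqF.
have alA : `|al| <= A by rewrite normrM ler_pM.
have al1 : `|al - al0| <= D * K * h.
  by rewrite -mulrBl normrM mulrAC ler_pM.
have beB : `|be| <= B.
  rewrite normrN !normrM (ger0_norm (ltW s0)) ger0_norm; last by rewrite invr_ge0.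
  have xX2 : `|x + x0| <= X + X by rewrite (le_trans (ler_normD _ _))// lerD.
  apply: ler_pM; rewrite ?mulr_ge0 ?invr_ge0//; last by rewrite ler_pM.
  by rewrite ler_wpM2l// mulr_ge0 ?invr_ge0.
have be1 : `|be - be0| <= sigma / 2 * K * (D * (X + 2 * X)) * h.
  have -> : be - be0 = - (sigma / 2 * V * ((x - x0) * (x + 2 * x0))) by rewrite /be /be0; field.
  have -> : sigma / 2 * K * (D * (X + 2 * X)) * h = sigma / 2 * K * (D * h * (X + 2 * X)) by ring.
  rewrite normrN !normrM (ger0_norm (ltW s0)) ger0_norm; last by rewrite invr_ge0.
  have xX2 : `|x + 2 * x0| <= X + 2 * X.
    by rewrite (le_trans (ler_normD _ _))// lerD// normrM ger0_norm// ler_pM.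
  apply: ler_pM; rewrite ?mulr_ge0 ?invr_ge0//; last by rewrite ler_pM.
  by rewrite ler_wpM2l// mulr_ge0 ?invr_ge0.
have b1 : 0 <= sigma ^+ 2 * x ^+ 2 / 2.
  by rewrite divr_ge0//; apply: mulr_ge0; exact: sqr_ge0.
have e1 : e <= 1 by rewrite expR_le1 oppr_le0.
have e0 : 0 <= e by exact: expR_ge0.
have b0 : 0 <= u ^+ 2 / 2 by rewrite divr_ge0 ?sqr_ge0.
have ep : `|e - p| <= h * B.
  apply: (le_trans (expRN_lipschitz _ _ _ b0 b1)).
  by rewrite bE normrM (ger0_norm h0) ler_wpM2l.
have ep2 : `|e - p + p * (h * be)| <= (h * B) ^+ 2.
  rewrite -bE; apply: (le_trans (expRN_taylor1 _ _ _ b0 b1)).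
  rewrite bE -[leLHS]real_normK ?num_real// !expr2 normrM (ger0_norm h0).
  by rewrite ler_pM ?mulr_ge0// ler_wpM2l.
have cE : cis (- (u * (mu + h * U) / q)) * psi mu sigma (u / q)
          = cis (- (h * al)) * RtoC e.
  rewrite /psi -xE -/e mulrCA -cisD mulrC; congr (cis _ * _).
  by rewrite /al xE; field; rewrite -?/q ?gt_eqF.
rewrite cE.
have -> : cis (- (h * al)) * RtoC e - RtoC p - RtoC h * G0_drift sigma U V u =
  (cis (- (h * al)) - 1 - (0 +i* 1)%C * RtoC (- (h * al))) * RtoC e
  + RtoC (e - p + p * (h * be)) - (0 +i* 1)%C * RtoC (h * al * (e - p))
  - (0 +i* 1)%C * RtoC (h * (al - al0) * p) - RtoC (h * (be - be0) * p).
  rewrite /G0_drift -/p.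
  have -> : u / sigma * p * U = al0 * p by rewrite /al0 x0E; ring.
  have -> : u ^+ 2 / sigma * p * V = - (be0 * p) by rewrite /be0 x0E; field; rewrite -?/q ?gt_eqF.
  by rewrite !(RtoCM, RtoCD, RtoCN, RtoCB); ring.
have hp : 0 <= h ^+ 2 by rewrite sqr_ge0.
have p0 := psi0_ge0 u; have p1 := psi0_le1 u.
rewrite -/p in p0 p1.
have n1 : normc ((cis (- (h * al)) - 1 - (0 +i* 1)%C * RtoC (- (h * al))) * RtoC e)
    <= 2 * A ^+ 2 * h ^+ 2.
  rewrite normcM normc_RtoC (ger0_norm e0) -[leRHS]mulr1 ler_pM ?normc_ge0//.
  rewrite (le_trans (cis_taylor1 _ _))// sqrrN exprMn -mulrA ler_wpM2l// mulrC ler_wpM2r//.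
  by rewrite -[leLHS]real_normK ?num_real// lerXn2r ?nnegrE.
have n2 : normc (RtoC (e - p + p * (h * be))) <= B ^+ 2 * h ^+ 2.
  by rewrite normc_RtoC (le_trans ep2)// exprMn mulrC.
have n3 : normc ((0 +i* 1)%C * RtoC (h * al * (e - p))) <= A * B * h ^+ 2.
  rewrite normcM normc_i mul1r normc_RtoC !normrM (ger0_norm h0).
  by rewrite (_ : A * B * h ^+ 2 = h * A * (h * B)); [rewrite !ler_pM ?mulr_ge0|ring].
have n4 : normc ((0 +i* 1)%C * RtoC (h * (al - al0) * p)) <= D * K * h ^+ 2.
  rewrite normcM normc_i mul1r normc_RtoC !normrM (ger0_norm h0) (ger0_norm p0).
  rewrite (_ : D * K * h ^+ 2 = h * (D * K * h) * 1); last ring.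
  by rewrite !ler_pM ?mulr_ge0.
have n5 : normc (RtoC (h * (be - be0) * p)) <= sigma / 2 * K * (D * (X + 2 * X)) * h ^+ 2.
  rewrite normc_RtoC !normrM (ger0_norm h0) (ger0_norm p0).
  rewrite (_ : sigma / 2 * K * (D * (X + 2 * X)) * h ^+ 2
    = h * (sigma / 2 * K * (D * (X + 2 * X)) * h) * 1); last ring.
  by rewrite !ler_pM ?mulr_ge0.
do 3 (rewrite [leRHS]mulrDl; apply: (le_trans (le_normcB _ _ _)); apply: lerD => //).
rewrite [leRHS]mulrDl.
by apply: (le_trans (le_normcD _ _)); exact: lerD.
Qed.

(** In the unit disc powers stay bounded by 1, so splitting off one factor at a time costs only a
    polynomial constant; the induction closes with (m+1) + (m+1)^2 <= (m+2)^2. *)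
Lemma pow_linearization (f p : R[i]) m : normc f <= 1 -> normc p <= 1 ->
  normc (f ^+ m.+1 - p ^+ m.+1 - m.+1%:R * p ^+ m * (f - p))
    <= m.+1%:R ^+ 2 * normc (f - p) ^+ 2.
Proof.
move=> f1 p1.
have le1 k : normc (f ^+ k - p ^+ k) <= k%:R * normc (f - p).
  elim: k => [|k IH]; first by rewrite !expr0 subrr normc0 mul0r.
  have -> : f ^+ k.+1 - p ^+ k.+1 = f * (f ^+ k - p ^+ k) + p ^+ k * (f - p).
    by rewrite !exprS; ring.
  rewrite (le_trans (le_normcD _ _))// -natr1 mulrDl mul1r lerD// normcM.
    by rewrite (le_trans _ IH)// ler_piMl ?normc_ge0.
  by rewrite ler_piMl ?normc_ge0// normcX exprn_ile1 ?normc_ge0.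
elim: m => [|m IH].
  by rewrite !expr1 expr0 mulr1 mul1r subrr normc0 mulr_ge0 ?sqr_ge0.
have -> : f ^+ m.+2 - p ^+ m.+2 - m.+2%:R * p ^+ m.+1 * (f - p) =
  (f ^+ m.+1 - p ^+ m.+1) * (f - p)
    + p * (f ^+ m.+1 - p ^+ m.+1 - m.+1%:R * p ^+ m * (f - p)).
  by rewrite -[m.+2%:R]natr1 !exprS; ring.
apply: (le_trans (le_normcD _ _)).
apply: (@le_trans _ _ (m.+1%:R * normc (f - p) ^+ 2 + m.+1%:R ^+ 2 * normc (f - p) ^+ 2)).
  rewrite lerD//.
    by rewrite normcM expr2 mulrA ler_wpM2r ?normc_ge0.
  by rewrite normcM (le_trans _ IH)// ler_piMl ?normc_ge0.
rewrite -mulrDl ler_wpM2r ?sqr_ge0// -[m.+2%:R]natr1.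
have : 0 <= m.+1%:R :> R by []. nra.
Qed.

End linearization.

(** * Sample statistics *)

Section sample.
Variable R : realType.
Implicit Types (n : nat) (x : nat -> R) (s u K : R).

Lemma sum_sqr_dev n x : (0 < n)%N ->
  \sum_(k < n) (x k - smean n x) ^+ 2
  = \sum_(k < n) x k ^+ 2 - n%:R * smean n x ^+ 2.
Proof.
move=> n0; have nN0 : n%:R != 0 :> R by rewrite pnatr_eq0 -lt0n.
have Sx : \sum_(k < n) x k = n%:R * smean n x by rewrite mulrA divff ?mul1r.
under eq_bigr do rewrite sqrrB.
rewrite big_split sumrB /= sumrMnl -mulr_suml Sx sumr_const card_ord -mulr_natl.
by rewrite -[_ *+ 2]mulr_natl; ring.
Qed.

Lemma mean_sqr n x : (0 < n)%N ->
  n%:R^-1 * \sum_(k < n) x k ^+ 2 = smean n x ^+ 2 + ssdev n x ^+ 2.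
Proof.
move=> n0; have nN0 : n%:R != 0 :> R by rewrite pnatr_eq0 -lt0n.
rewrite sqr_sqrtr; last first.
  by rewrite mulr_ge0 ?invr_ge0// sumr_ge0// => k _; rewrite sqr_ge0.
by rewrite sum_sqr_dev// mulrBr mulKf// addrC subrK.
Qed.

Lemma RtoC_natV n : RtoC n%:R^-1 = n%:R^-1 :> R[i].
Proof. by rewrite RtoCV RtoC_nat. Qed.

Lemma normc_ecf_le1 n x s : (0 < n)%N -> normc (ecf n x s) <= 1.
Proof.
move=> n0; have nN0 : n%:R != 0 :> R by rewrite pnatr_eq0 -lt0n.
rewrite /ecf -RtoC_natV normcM normc_RtoC ger0_norm ?invr_ge0//.
rewrite -[leRHS](mulVf nN0) ler_wpM2l ?invr_ge0// (le_trans (le_normc_sum _ _ _ _))//.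
by under eq_bigr do rewrite normc_cis; rewrite sumr_const card_ord.
Qed.

Lemma normc_secf_le1 n x u : (0 < n)%N -> normc (secf n x u) <= 1.
Proof. by move=> n0; rewrite normcM normc_cis mul1r normc_ecf_le1. Qed.

(** From 2 |x k| <= 1 + (x k)^2, and because the average of the squares is a function of the mean
    and the standard deviation. Bounds on these two statistics therefore control the Lipschitz
    constant, whatever the individual observations are. *)
Lemma ecf_lipschitz n x s1 s2 : (0 < n)%N ->
  normc (ecf n x s1 - ecf n x s2)
    <= (1 + smean n x ^+ 2 + ssdev n x ^+ 2) * `|s1 - s2|.
Proof.
move=> n0; have nN0 : n%:R != 0 :> R by rewrite pnatr_eq0 -lt0n.
rewrite /ecf -mulrBr -sumrB -RtoC_natV normcM normc_RtoC ger0_norm ?invr_ge0//.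
rewrite -addrA -mean_sqr//.
have -> : 1 + n%:R^-1 * \sum_(k < n) x k ^+ 2
        = n%:R^-1 * \sum_(k < n) (1 + x k ^+ 2).
  by rewrite big_split /= sumr_const card_ord mulrDr mulVf.
rewrite -mulrA ler_wpM2l ?invr_ge0// mulr_suml (le_trans (le_normc_sum _ _ _ _))//.
apply: ler_sum => k _; rewrite (le_trans (cis_lipschitz _ _ _))// -mulrBl normrM.
rewrite mulrCA mulrC ler_wpM2r//.
have := sqr_ge0 (`|x k| - 1); rewrite -[x k ^+ 2]real_normK ?num_real//.
by rewrite sqrrB1 mulr2n; lra.
Qed.

Lemma psi_lipschitz (mu sigma X : R) s1 s2 : `|s1| <= X -> `|s2| <= X ->
  normc (psi mu sigma s1 - psi mu sigma s2)
    <= (sigma ^+ 2 * X + 2 * `|mu|) * `|s1 - s2|.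
Proof.
move=> h1 h2; have X0 : 0 <= X := le_trans (normr_ge0 _) h1.
pose b s := sigma ^+ 2 * s ^+ 2 / 2.
have b0 s : 0 <= b s by rewrite divr_ge0//; apply: mulr_ge0; exact: sqr_ge0.
have -> : psi mu sigma s1 - psi mu sigma s2
  = RtoC (expR (- b s1) - expR (- b s2)) * cis (mu * s1)
    + RtoC (expR (- b s2)) * (cis (mu * s1) - cis (mu * s2)).
  by rewrite /psi RtoCB; ring.
rewrite mulrDl (le_trans (le_normcD _ _))// lerD// normcM normc_RtoC.
  rewrite normc_cis mulr1 (le_trans (expRN_lipschitz _ _ _ (b0 _) (b0 _)))//.
  rewrite (_ : b s1 - b s2 = sigma ^+ 2 * ((s1 + s2) / 2) * (s1 - s2)).
    rewrite normrM ler_wpM2r// normrM ger0_norm ?sqr_ge0// ler_wpM2l ?sqr_ge0//.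
    rewrite normrM [`|2^-1|]ger0_norm ?invr_ge0// ler_pdivrMr// mulr2n mulrDr mulr1.
    by rewrite (le_trans (ler_normD _ _))// lerD.
  by rewrite /b; field.
rewrite -[leRHS]mul1r ler_pM ?normc_ge0//.
  by rewrite ger0_norm ?expR_ge0// expR_le1 oppr_le0.
by rewrite (le_trans (cis_lipschitz _ _ _))// -mulrBr normrM mulrA.
Qed.

Definition Zn (mu sigma : R) n x s : R[i] :=
  RtoC (Num.sqrt n%:R) * (ecf n x s - psi mu sigma s).
Definition Un (mu : R) n x : R := Num.sqrt n%:R * (smean n x - mu).
Definition Vn (sigma : R) n x : R := Num.sqrt n%:R * (ssdev n x - sigma).

(* The event on which the error analysis is deterministic. *)
Definition tame (a K eta delta : R) (g : R -> R[i]) (y1 y2 : R) : Prop :=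
  [/\ `|y1| <= K, `|y2| <= K,
      forall s, `|s| <= a -> normc (g s) <= K &
      forall s s', `|s| <= a -> `|s'| <= a -> `|s - s'| < delta ->
        normc (g s - g s') <= eta].

Lemma normc_G0 (mu sigma T K : R) (g : R -> R[i]) (y1 y2 u : R) :
  0 < sigma -> (forall s, `|s| <= T / sigma -> normc (g s) <= K) ->
  `|y1| <= K -> `|y2| <= K -> `|u| <= T ->
  normc (G0 mu sigma g y1 y2 u) <= (1 + T / sigma + T ^+ 2 / sigma) * K.
Proof.
move=> s0 gK y1K y2K uT; have K0 : 0 <= K := le_trans (normr_ge0 _) y1K.
have si : 0 <= sigma^-1 by rewrite invr_ge0 ltW.
have T0 : 0 <= T := le_trans (normr_ge0 _) uT.
rewrite /G0 !mulrDl mul1r (le_trans (le_normcD _ _))// lerD//.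
  rewrite (le_trans (le_normcB _ _ _))// lerD// normcM.
    rewrite normc_cis mul1r gK// normrM (ger0_norm si) ler_wpM2r//.
  rewrite normc_i mul1r normc_RtoC !normrM (ger0_norm si) ler_pM ?mulr_ge0//.
  rewrite -[leRHS]mulr1 ler_pM ?mulr_ge0// ?ler_pM//.
  by rewrite ger0_norm ?psi0_ge0// psi0_le1.
rewrite normc_RtoC normrM ler_pM// normrM -[leRHS]mulr1 ler_pM//.
  rewrite normrM (ger0_norm si) ler_wpM2r// normrX lerXn2r ?nnegrE//.
by rewrite ger0_norm ?psi0_ge0// psi0_le1.
Qed.

Section scaled.
Variables (mu sigma : R) (n : nat) (x : nat -> R).
Hypothesis n0 : (0 < n)%N.
Let h : R := (Num.sqrt n%:R)^-1.

Lemma sqrtn_gt0 : 0 < Num.sqrt n%:R :> R.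
Proof. by rewrite sqrtr_gt0 ltr0n. Qed.

Lemma smean_Un : smean n x = mu + h * Un mu n x.
Proof. by rewrite /h /Un mulKf ?gt_eqF ?sqrtn_gt0// addrC subrK. Qed.

Lemma ssdev_Vn : ssdev n x = sigma + h * Vn sigma n x.
Proof. by rewrite /h /Vn mulKf ?gt_eqF ?sqrtn_gt0// addrC subrK. Qed.

Lemma ecf_Zn s : ecf n x s = psi mu sigma s + RtoC h * Zn mu sigma n x s.
Proof.
rewrite /h /Zn mulrA -RtoCM mulVf ?gt_eqF ?sqrtn_gt0//.
by rewrite RtoC1 mul1r addrC subrK.
Qed.

End scaled.

Lemma secf_linearization (mu sigma T K : R) : 0 < sigma -> 0 <= T -> 0 <= K ->
  exists2 C, 0 <= C & forall n x eta delta, (0 < n)%N ->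
    let h := (Num.sqrt n%:R)^-1 in
    h <= 1 -> h * K <= sigma / 2 -> C * h < delta ->
    tame (T / sigma) K eta delta
      (Zn mu sigma n x) (Un mu n x) (Vn sigma n x) ->
    forall u, `|u| <= T ->
    let r := normc (secf n x u - RtoC (psi0 u) - RtoC h *
       G0 mu sigma (Zn mu sigma n x) (Un mu n x) (Vn sigma n x) u) in
    r <= h * C /\ (`|u| <= T / sigma * ssdev n x -> r <= h * (C * h + eta)).
Proof.
move=> s0 T0 K0; have [C1 C10 lin] := cf_linearization _ mu sigma T K s0 T0 K0.
have sl : 0 <= sigma by exact: ltW.
pose D := 2 * T * K / sigma ^+ 2; pose X := 2 * T / sigma.
have D0 : 0 <= D by rewrite !mulr_ge0 ?invr_ge0 ?sqr_ge0.
have X0 : 0 <= X by rewrite !mulr_ge0 ?invr_ge0.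
pose E := 2 * (D * `|mu| + X * K).
have E0 : 0 <= E by clearbody D X; rewrite mulr_ge0 // addr_ge0 // mulr_ge0.
(* The Lipschitz constant of [ecf], with mean and deviation bounded using h <= 1, plus that of [psi]
   on [-X, X]. *)
pose L := (1 + (`|mu| + K) ^+ 2 + (sigma + K) ^+ 2) + (sigma ^+ 2 * X + 2 * `|mu|).
have L0 : 0 <= L.
  have := mulr_ge0 (sqr_ge0 sigma) X0; have := sqr_ge0 (`|mu| + K).
  have := sqr_ge0 (sigma + K); have := normr_ge0 mu; rewrite /L; lra.
(* The last summand makes C h < delta put u / S within delta of u / sigma. *)
exists (C1 + E * K + L * D + D).
  by clearbody D X E L; rewrite !addr_ge0 ?mulr_ge0.
move=> n x eta delta n0 /=; set h := _^-1 => h1 hK hd [UK VK ZK Zeta] u uT.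
set U := Un mu n x; set V := Vn sigma n x; set Z := Zn mu sigma n x.
rewrite -/U -/V -/Z in UK VK ZK Zeta.
have h0 : 0 <= h by rewrite invr_ge0 sqrtr_ge0.
have mE := smean_Un mu n x n0; have sE := ssdev_Vn sigma n x n0.
rewrite -/U -/V -/h in mE sE.
set S := ssdev n x in sE *; set xb := smean n x in mE *.
have Sg := near_sigma _ _ _ _ _ s0 h0 hK VK; rewrite -sE in Sg.
have S0 : 0 < S by apply: lt_le_trans Sg; lra.
have uX : `|u / S| <= X by rewrite sE (norm_div_sdev _ sigma K).
have uD : `|u / S - u / sigma| <= D * h by rewrite sE div_sdev_dist.
have us : `|u / sigma| <= T / sigma.
  by rewrite normrM [`|sigma^-1|]ger0_norm ?invr_ge0// ler_wpM2r ?invr_ge0.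
have uX' : `|u / sigma| <= X.
  by rewrite (le_trans us)// ler_wpM2r ?invr_ge0//; lra.
set c := cis (- (u * xb / S)); set c0 := cis (- (u * mu / sigma)).
have cc : normc (c - c0) <= E * h.
  rewrite (le_trans (cis_lipschitz _ _ _))// /E -[leRHS]mulrA ler_wpM2l//.
  have -> : - (u * xb / S) - - (u * mu / sigma)
      = - ((u / S - u / sigma) * mu + h * (u / S * U)).
    by rewrite mE; field; rewrite !gt_eqF.
  rewrite normrN (le_trans (ler_normD _ _))// [leRHS]mulrDl.
  apply: lerD; first by rewrite normrM [leRHS]mulrAC ler_wpM2r.
  rewrite normrM (ger0_norm h0) mulrC ler_wpM2r// normrM ler_pM//.
have Lip : normc (Z (u / S) - Z (u / sigma)) <= L * D.
  have -> : Z (u / S) - Z (u / sigma) = RtoC h^-1 * ((ecf n x (u / S) - ecf n x (u / sigma))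
      - (psi mu sigma (u / S) - psi mu sigma (u / sigma))).
    by rewrite /Z /Zn /h invrK; ring.
  have hp : 0 < h by rewrite invr_gt0 sqrtn_gt0.
  rewrite normcM normc_RtoC ger0_norm ?invr_ge0// ler_pdivrMl//.
  have e1 := ecf_lipschitz n x (u / S) (u / sigma) n0.
  have e2 := psi_lipschitz mu sigma X (u / S) (u / sigma) uX uX'.
  have hU y : `|y| <= K -> `|h * y| <= K.
    by move=> yK; rewrite normrM (ger0_norm h0) -[leRHS]mul1r ler_pM.
  apply: (le_trans (le_normcB _ _ _)).
  apply: (@le_trans _ _ (L * `|u / S - u / sigma|)).
    rewrite mulrDl lerD// (le_trans e1)// ler_wpM2r// lerD//.
      rewrite lerD2l -/xb mE -[leLHS]real_normK ?num_real// lerXn2r ?nnegrE ?addr_ge0//.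
      by rewrite (le_trans (ler_normD _ _))// lerD2l hU.
    rewrite -/S sE -[leLHS]real_normK ?num_real// lerXn2r ?nnegrE ?addr_ge0//.
    by rewrite (le_trans (ler_normD _ _))// lerD ?hU// ger0_norm.
  by rewrite [leRHS]mulrCA ler_wpM2l// [leRHS]mulrC.
set r := normc _.
have rE : r <= C1 * h ^+ 2 + h * (E * h * K + normc (Z (u / S) - Z (u / sigma))).
  rewrite /r /secf -/xb -/S -/c (ecf_Zn mu sigma)// -/h -/Z.
  (* The deterministic expansion is split off. In the remaining random term the phase moves from [c]
     to [c0] and the argument of [Z] from u / S to u / sigma. *)
  have -> : c * (psi mu sigma (u / S) + RtoC h * Z (u / S)) - RtoC (psi0 u)
      - RtoC h * G0 mu sigma Z U V u
    = (c * psi mu sigma (u / S) - RtoC (psi0 u) - RtoC h * G0_drift _ sigma U V u)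
      + RtoC h * ((c - c0) * Z (u / sigma) + c * (Z (u / S) - Z (u / sigma))).
    by rewrite /G0 -/c0 /G0_drift; ring.
  rewrite (le_trans (le_normcD _ _))// lerD//.
    by have := lin h U V u h0 hK UK VK uT; rewrite -sE -mE.
  rewrite normcM normc_RtoC (ger0_norm h0) ler_wpM2l// (le_trans (le_normcD _ _))//.
  by rewrite lerD// normcM ?normc_cis ?mul1r// ler_pM ?normc_ge0// ZK.
have hh : h ^+ 2 <= h by rewrite expr2 ler_piMl.
have CD : 0 <= L * D by rewrite mulr_ge0.
have EK : 0 <= E * K by rewrite mulr_ge0.
split=> [|uS]; apply: (le_trans rE).
  apply: (@le_trans _ _ (C1 * h + h * (E * K + L * D))).
    rewrite lerD ?ler_wpM2l// lerD// -mulrA mulrCA.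
    by rewrite ler_piMl.
  by rewrite mulrC -mulrDr ler_wpM2l// !addrA lerDl.
have Zd : normc (Z (u / S) - Z (u / sigma)) <= eta.
  apply: Zeta => //.
    by rewrite normrM [`|S^-1|]ger0_norm ?invr_ge0 ?(ltW S0)// ler_pdivrMr.
  apply: (le_lt_trans uD); apply: (le_lt_trans _ hd); rewrite ler_wpM2r//.
  by rewrite lerDr !addr_ge0.
apply: (@le_trans _ _ (h * (C1 * h + E * K * h + eta))).
  by rewrite expr2 mulrCA -mulrDr ler_wpM2l// addrA lerD// lerD// mulrAC.
rewrite ler_wpM2l// lerD2r -mulrDl ler_wpM2r// -addrA lerDl.
by rewrite addr_ge0.
Qed.

End sample.

(** * Measurability *)

Section measurability.
Variable R : realType.

(** The inverse is total but discontinuous at 0, so this point is split off. The sample deviation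
    may vanish, hence 0 cannot be excluded. *)
Lemma measurable_invr : measurable_fun setT (fun x : R => x^-1).
Proof.
rewrite -(setUv [set (0 : R)]); apply/measurable_funU => //; first exact: measurableC.
split; first exact: measurable_fun_set1.
apply: open_continuous_measurable_fun.
  by rewrite openC; exact: accessible_closed_set1 (@hausdorff_accessible _ (@Rhausdorff R)) _.
by move=> x; rewrite inE/= => /eqP x0; exact: inv_continuous.
Qed.

Context d (S : measurableType d).
Implicit Types (f g : S -> R) (F G : S -> R[i]) (xs : nat -> S -> R).

Lemma measurable_funV f : measurable_fun setT f -> measurable_fun setT (fun s => (f s)^-1).
Proof. by move=> mf; exact: measurableT_comp measurable_invr mf. Qed.

Lemma measurable_funT_opp f : measurable_fun setT f -> measurable_fun setT (fun s => - f s).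
Proof. by move=> mf; exact: measurableT_comp mf. Qed.

Lemma measurable_funT_div f g : measurable_fun setT f -> measurable_fun setT g ->
  measurable_fun setT (fun s => f s / g s).
Proof. by move=> mf /measurable_funV mg; exact: measurable_funM. Qed.

Lemma measurable_funT_sum n xs : (forall k, measurable_fun setT (xs k)) ->
  measurable_fun setT (fun s => \sum_(k < n) xs k s).
Proof. by move=> mx; apply: measurable_sum => k. Qed.

Lemma measurable_funT_sqrt f : measurable_fun setT f ->
  measurable_fun setT (fun s => Num.sqrt (f s)).
Proof.
move=> mf; apply: measurableT_comp mf.
by apply: continuous_measurable_fun; exact: sqrt_continuous.
Qed.

Lemma measurable_smean n xs : (forall k, measurable_fun setT (xs k)) ->
  measurable_fun setT (fun s => smean n (fun k => xs k s)).
Proof.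
by move=> mx; apply: measurable_funM => //; exact: measurable_funT_sum.
Qed.

Lemma measurable_ssdev n xs : (forall k, measurable_fun setT (xs k)) ->
  measurable_fun setT (fun s => ssdev n (fun k => xs k s)).
Proof.
move=> mx; apply: measurable_funT_sqrt; apply: measurable_funM => //.
apply: measurable_sum => k; apply: measurable_funX.
by apply: measurable_funB => //; exact: measurable_smean.
Qed.

(** Componentwise, so that no sigma-algebra on [R[i]] has to be chosen. *)
Definition measurableC_fun F : Prop :=
  measurable_fun setT (fun s => complex.Re (F s)) /\
  measurable_fun setT (fun s => complex.Im (F s)).

Lemma measurableC_D F G : measurableC_fun F -> measurableC_fun G ->
  measurableC_fun (fun s => F s + G s).
Proof.
move=> [F1 F2] [G1 G2]; split; [move: F1 G1|move: F2 G2].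
  move=> m1 m2; rewrite [X in measurable_fun _ X](_ : _ =
    (fun s => complex.Re (F s)) \+ (fun s => complex.Re (G s))); first exact: measurable_funD.
  by apply/funext => s /=; case: (F s) => ? ?; case: (G s).
move=> m1 m2; rewrite [X in measurable_fun _ X](_ : _ =
  (fun s => complex.Im (F s)) \+ (fun s => complex.Im (G s))); first exact: measurable_funD.
by apply/funext => s /=; case: (F s) => ? ?; case: (G s).
Qed.

Lemma measurableC_N F : measurableC_fun F -> measurableC_fun (fun s => - F s).
Proof.
move=> [F1 F2]; split.
  rewrite [X in measurable_fun _ X](_ : _ = \- (fun s => complex.Re (F s)));
    first exact: measurable_funT_opp.
  by apply/funext => s /=; case: (F s).
rewrite [X in measurable_fun _ X](_ : _ = \- (fun s => complex.Im (F s)));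
  first exact: measurable_funT_opp.
by apply/funext => s /=; case: (F s).
Qed.

Lemma measurableC_B F G : measurableC_fun F -> measurableC_fun G ->
  measurableC_fun (fun s => F s - G s).
Proof. by move=> mF /measurableC_N mG; exact: measurableC_D. Qed.

Lemma measurableC_M F G : measurableC_fun F -> measurableC_fun G ->
  measurableC_fun (fun s => F s * G s).
Proof.
move=> [F1 F2] [G1 G2]; split.
  rewrite [X in measurable_fun _ X](_ : _ =
    ((fun s => complex.Re (F s)) \* (fun s => complex.Re (G s))) \-
    ((fun s => complex.Im (F s)) \* (fun s => complex.Im (G s)))).
    by apply: measurable_funB; exact: measurable_funM.
  by apply/funext => s /=; case: (F s) => ? ?; case: (G s).
rewrite [X in measurable_fun _ X](_ : _ =
  ((fun s => complex.Re (F s)) \* (fun s => complex.Im (G s))) \+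
  ((fun s => complex.Im (F s)) \* (fun s => complex.Re (G s)))).
  by apply: measurable_funD; exact: measurable_funM.
by apply/funext => s /=; case: (F s) => ? ?; case: (G s).
Qed.

Lemma measurableC_cst (c : R[i]) : measurableC_fun (fun=> c).
Proof. by split; exact: measurable_cst. Qed.

Lemma measurableC_RtoC f : measurable_fun setT f -> measurableC_fun (fun s => RtoC (f s)).
Proof. by move=> mf; split => //=; exact: measurable_cst. Qed.

Lemma measurableC_cis f : measurable_fun setT f -> measurableC_fun (fun s => cis (f s)).
Proof.
move=> mf; split => /=; apply: measurableT_comp mf; apply: continuous_measurable_fun.
  exact: continuous_cos.
exact: continuous_sin.
Qed.

Lemma measurableC_X F n : measurableC_fun F -> measurableC_fun (fun s => F s ^+ n).
Proof.
move=> mF; elim: n => [|n IH]; first exact: measurableC_cst.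
rewrite [X in measurableC_fun X](_ : _ = fun s => F s * F s ^+ n).
  exact: measurableC_M.
by apply/funext => s; rewrite exprS.
Qed.

Lemma measurableC_sum n (F : nat -> S -> R[i]) : (forall k, measurableC_fun (F k)) ->
  measurableC_fun (fun s => \sum_(k < n) F k s).
Proof.
move=> mF; elim: n => [|n IH].
  rewrite [X in measurableC_fun X](_ : _ = fun=> 0); first exact: measurableC_cst.
  by apply/funext => s; rewrite big_ord0.
rewrite [X in measurableC_fun X](_ : _ = fun s => \sum_(k < n) F k s + F n s).
  exact: measurableC_D.
by apply/funext => s; rewrite big_ord_recr.
Qed.

Lemma measurable_normsq F : measurableC_fun F -> measurable_fun setT (fun s => normsq (F s)).
Proof. by move=> [F1 F2]; apply: measurable_funD; exact: measurable_funX. Qed.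

Lemma measurable_normc F : measurableC_fun F -> measurable_fun setT (fun s => normc (F s)).
Proof.
move=> mF; under eq_fun do rewrite -sqrt_normsq.
by apply: measurable_funT_sqrt; exact: measurable_normsq.
Qed.

Lemma measurable_expRN_sqr (c : R) f : measurable_fun setT f ->
  measurable_fun setT (fun s => expR (- (c * f s ^+ 2))).
Proof.
move=> mf; apply: measurableT_comp; first exact: measurable_expR.
by apply: measurable_funT_opp; apply: measurable_funM => //; exact: measurable_funX.
Qed.

Lemma measurable_psi0 f : measurable_fun setT f -> measurable_fun setT (fun s => psi0 (f s)).
Proof.
move=> mf; have := measurable_expRN_sqr 2^-1 f mf.
by under eq_fun do rewrite mulrC.
Qed.

Lemma measurableC_psi (mu sigma : R) f : measurable_fun setT f ->
  measurableC_fun (fun s => psi mu sigma (f s)).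
Proof.
move=> mf; apply: measurableC_M; last first.
  by apply: measurableC_cis; exact: measurable_funM.
apply: measurableC_RtoC; have := measurable_expRN_sqr (sigma ^+ 2 / 2) f mf.
by under eq_fun do rewrite mulrAC.
Qed.

(** Evaluating at a measurable [f s] covers two uses at once: joint measurability in sample and
    argument when S is a product space, and measurability in the argument alone when the sample is
    constant. *)
Lemma measurableC_ecf n xs f : (forall k, measurable_fun setT (xs k)) ->
  measurable_fun setT f ->
  measurableC_fun (fun s => ecf n (fun k => xs k s) (f s)).
Proof.
move=> mx mf; apply: measurableC_M; first exact: measurableC_cst.
apply: (@measurableC_sum _ (fun k s => cis (f s * xs k s))) => k.
by apply: measurableC_cis; exact: measurable_funM.
Qed.

Lemma measurableC_Dm n xs m f : (forall k, measurable_fun setT (xs k)) ->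
  measurable_fun setT f ->
  measurableC_fun (fun s => Dm n (fun k => xs k s) m (f s)).
Proof.
move=> mx mf; have mS j : measurableC_fun (fun s => Sm n (fun k => xs k s) j (f s)).
  have mt : measurable_fun setT (fun s => f s / Num.sqrt j%:R).
    exact: measurable_funM.
  have mdev := measurable_ssdev n xs mx.
  apply: measurableC_X; apply: measurableC_M.
    apply: measurableC_cis; apply: measurable_funT_opp; apply: measurable_funT_div => //.
    by apply: measurable_funM => //; exact: measurable_smean.
  by apply: measurableC_ecf => //; exact: measurable_funT_div.
exact: measurableC_B.
Qed.

(** The hypothesis on [g] stands for joint measurability: it is tested along every measurable choice
    of the argument, as [G0] evaluates [g] at rescaled points. *)
Lemma measurableC_Hm (mu sigma : R) (g : S -> R -> R[i]) (y1 y2 : S -> R) m f :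
  (forall f', measurable_fun setT f' -> measurableC_fun (fun s => g s (f' s))) ->
  measurable_fun setT y1 -> measurable_fun setT y2 -> measurable_fun setT f ->
  measurableC_fun (fun s => Hm mu sigma (g s) (y1 s) (y2 s) m (f s)).
Proof.
move=> mg my1 my2 mf.
have mH (j : nat) : measurableC_fun (fun s => j%:R *
    (G0 mu sigma (g s) (y1 s) (y2 s) (f s / Num.sqrt j%:R)
     / RtoC (psi0 (f s / Num.sqrt j%:R)))).
  have mt : measurable_fun setT (fun s => f s / Num.sqrt j%:R).
    exact: measurable_funM.
  apply: measurableC_M; first exact: measurableC_cst.
  apply: measurableC_M; last first.
    under eq_fun do rewrite -RtoCV.
    by apply: measurableC_RtoC; apply: measurable_funV; exact: measurable_psi0.
  have mp := measurable_psi0 _ mt.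
  apply: measurableC_D; [apply: measurableC_B|].
  - apply: measurableC_M; last by apply: mg; exact: measurable_funM.
    apply: measurableC_cis; apply: measurable_funT_opp; apply: measurable_funM => //.
    exact: measurable_funM.
  - apply: measurableC_M; first exact: measurableC_cst.
    apply: measurableC_RtoC; apply: measurable_funM => //.
    by apply: measurable_funM => //; exact: measurable_funM.
  - apply: measurableC_RtoC; apply: measurable_funM => //.
    by apply: measurable_funM => //; apply: measurable_funM => //; exact: measurable_funX.
exact: measurableC_B.
Qed.

Lemma measurableC_Zn (mu sigma : R) n xs f : (forall k, measurable_fun setT (xs k)) ->
  measurable_fun setT f ->
  measurableC_fun (fun s => Zn _ mu sigma n (fun k => xs k s) (f s)).
Proof.
move=> mx mf; apply: measurableC_M; first exact: measurableC_cst.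
by apply: measurableC_B; [exact: measurableC_ecf|exact: measurableC_psi].
Qed.

(** Tonelli, with the interval turned into an indicator factor. Nonnegativity takes the place of
    integrability, and [fine] is measurable also where the integral is infinite. *)
Lemma measurable_Rintegral_param (T : R) (h : S -> R -> R) :
  measurable_fun setT (fun p : S * R => h p.1 p.2) -> (forall s t, 0 <= h s t) ->
  measurable_fun setT (fun s =>
    (\int[@lebesgue_measure R]_(t in `[- T, T]) h s t)%R).
Proof.
move=> mh h0; apply: measurableT_comp; first exact: fine_measurable.
pose F (p : S * R) := ((h p.1 p.2)%:E * (\1_(`[- T, T]%classic : set R) p.2)%:E)%E.
have mF : measurable_fun setT F.
  apply: emeasurable_funM; first exact/measurable_EFinP.
  apply/measurable_EFinP; apply: measurableT_comp measurable_snd.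
  exact: measurable_indic.
have F0 p : (0 <= F p)%E by rewrite mule_ge0// lee_fin.
have := measurable_fun_fubini_tonelli_F F mF F0 (m2 := @lebesgue_measure R).
apply: eq_measurable_fun => s _; rewrite /fubini_F [RHS]integral_mkcond.
apply: eq_integral => t _; rewrite /F /= patchE indicE.
by case: ifPn => ?; rewrite ?mule1// mule0.
Qed.

End measurability.

(** * Pathwise comparison *)

Section comparison.
Variable R : realType.
Local Notation leb := (@lebesgue_measure R).
Implicit Types (f g : R -> R) (T c : R).

Lemma lebesgue_itvcc (a b : R) : a <= b -> leb `[a, b] = (b - a)%:E.
Proof.
move=> ab; rewrite lebesgue_measure_itv /= lte_fin.
case: ltP => [_|ba]; first by rewrite EFinB.
by rewrite (@le_anti _ _ a b) ?ab// subrr.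
Qed.

Lemma integrable_bounded_itv T c f : measurable_fun setT f ->
  (forall t, `|t| <= T -> `|f t| <= c) -> leb.-integrable `[- T, T] (EFin \o f).
Proof.
move=> mf fc; apply: measurable_bounded_integrable => //.
- rewrite -[X in (X < _)%E]/(leb `[- T, T]%classic) lebesgue_measure_itv /=.
  by case: ifP => // _; rewrite -EFinD ltry.
- exact: measurable_funTS.
- exists c; split; first exact: num_real.
  move=> M cM t /=; rewrite in_itv /= -ler_norml => /fc h.
  by apply: le_trans h _; exact: ltW.
Qed.

Lemma Rintegral_cst_itv T c : 0 <= T -> \int[leb]_(t in `[- T, T]) c = 2 * T * c.
Proof.
move=> T0; rewrite Rintegral_cst//=.
have TT : - T <= T by lra.
by have /(congr1 fine)/= -> := lebesgue_itvcc _ _ TT; ring.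
Qed.

Lemma Rintegral_indic_itv T a b : 0 <= T -> a <= b -> `[a, b] `<=` `[- T, T] ->
  \int[leb]_(t in `[- T, T]) (\1_(`[a, b]%classic : set R) t) = b - a.
Proof.
move=> T0 ab sub; rewrite /Rintegral integral_indic// setIidl//.
exact: (congr1 fine (lebesgue_itvcc a b ab)).
Qed.

(* The integrands are only close on [-(T - e), T - e]; the remaining set is short. *)
Lemma Rintegral_dist_le T e c c' M f g : 0 <= e <= T -> 0 <= c -> 0 <= c' ->
  measurable_fun setT f -> measurable_fun setT g ->
  (forall t, `|t| <= T -> `|g t| <= M) ->
  (forall t, `|t| <= T -> `|f t - g t| <= c') ->
  (forall t, `|t| <= T - e -> `|f t - g t| <= c) ->
  `|\int[leb]_(t in `[- T, T]) f t - \int[leb]_(t in `[- T, T]) g t|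
    <= 2 * T * c + 2 * e * c'.
Proof.
move=> /andP[e0 eT] c0 c'0 mf mg gM fg fgc; have T0 : 0 <= T := le_trans e0 eT.
have ig := integrable_bounded_itv T M g mg gM.
have if_ : leb.-integrable `[- T, T] (EFin \o f).
  apply: (integrable_bounded_itv T (M + c')) => // t tT.
  rewrite -(subrK (g t) (f t)) addrC (le_trans (ler_normD _ _))// lerD//.
    exact: gM.
  exact: fg.
have mfg : measurable_fun setT (fun t => f t - g t) by exact: measurable_funB.
have ifg : leb.-integrable `[- T, T] (EFin \o (fun t => f t - g t)).
  exact: (integrable_bounded_itv T c').
rewrite -RintegralB// (le_trans (le_normr_Rintegral _ ifg))//.
(* The two end pieces, each of length e, on which only the bound c' is available. *)
pose A := `[- T, - (T - e)]%classic : set R; pose B := `[T - e, T]%classic : set R.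
have sA : A `<=` `[- T, T].
  by move=> t; rewrite /A /= !in_itv/= => /andP[h1 h2]; apply/andP; split; lra.
have sB : B `<=` `[- T, T].
  by move=> t; rewrite /B /= !in_itv/= => /andP[h1 h2]; apply/andP; split; lra.
have i1 (D : set R) t : `|(\1_D t : R)| <= 1.
  by rewrite indicE; case: (t \in D); rewrite ?normr0 ?normr1.
have mA : measurable A by exact: measurable_itv.
have mB : measurable B by exact: measurable_itv.
have iA : leb.-integrable `[- T, T] (EFin \o (fun t => c' * \1_A t)).
  apply: (integrable_bounded_itv T c'); first exact: measurable_funM.
  by move=> t _; rewrite normrM ger0_norm// ler_piMr.
have iB : leb.-integrable `[- T, T] (EFin \o (fun t => c' * \1_B t)).
  apply: (integrable_bounded_itv T c'); first exact: measurable_funM.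
  by move=> t _; rewrite normrM ger0_norm// ler_piMr.
have ic : leb.-integrable `[- T, T] (EFin \o (fun=> c)).
  by apply: (integrable_bounded_itv T c) => // t _; rewrite ger0_norm.
have iAB : leb.-integrable `[- T, T] (EFin \o (fun t => c' * \1_A t + c' * \1_B t)).
  apply: (integrable_bounded_itv T (c' + c')).
    by apply: measurable_funD; exact: measurable_funM.
  move=> t _; rewrite (le_trans (ler_normD _ _))// lerD//;
  by rewrite normrM ger0_norm// ler_piMr.
have iT : leb.-integrable `[- T, T] (EFin \o (fun t => c + (c' * \1_A t + c' * \1_B t))).
  apply: (integrable_bounded_itv T (c + (c' + c'))).
    apply: measurable_funD => //.
    by apply: measurable_funD; exact: measurable_funM.
  move=> t _; rewrite (le_trans (ler_normD _ _))// lerD ?(ger0_norm c0)//.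
  rewrite (le_trans (ler_normD _ _))// lerD//;
  by rewrite normrM ger0_norm// ler_piMr.
have inA : leb.-integrable `[- T, T] (EFin \o (\1_A : R -> R)).
  exact: (integrable_bounded_itv T 1).
have inB : leb.-integrable `[- T, T] (EFin \o (\1_B : R -> R)).
  exact: (integrable_bounded_itv T 1).
apply: (@le_trans _ _ (\int[leb]_(t in `[- T, T]) (c + (c' * \1_A t + c' * \1_B t)))).
  apply: le_Rintegral => //.
    by apply: (integrable_bounded_itv T c'); [exact: measurableT_comp|move=> t tT; rewrite normr_id fg].
  move=> t /=; rewrite in_itv/= => tT.
  have tT' : `|t| <= T by rewrite ler_norml.
  have nA0 (D : set R) : 0 <= c' * \1_D t by rewrite mulr_ge0// indicE.
  have [te|te] := leP `|t| (T - e); first by rewrite (le_trans (fgc _ te))// lerDl addr_ge0.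
  rewrite (le_trans (fg _ tT'))//.
  case: (ger0P t) te => t0 te.
    have -> : \1_B t = 1 :> R.
      by rewrite indicE mem_set// /B/= in_itv/=; case/andP: tT => _ ->; rewrite ltW.
    by rewrite mulr1; have := nA0 A; lra.
  have -> : \1_A t = 1 :> R.
    rewrite indicE mem_set// /A/= in_itv/=; case/andP: tT => -> _ /=; lra.
  by rewrite mulr1; have := nA0 B; lra.
rewrite RintegralD// RintegralD// !RintegralZl//.
rewrite !Rintegral_indic_itv//; [|lra|lra].
by rewrite Rintegral_cst_itv//; lra.
Qed.

Lemma normsq_dist (z1 z2 : R[i]) :
  `|normsq z1 - normsq z2| <= normc (z1 - z2) * (normc (z1 - z2) + 2 * normc z2).
Proof.
rewrite !normsqE subr_sqr normrM.
have h1 := le_normc_dist _ z1 z2; have h2 := le_normc_dist _ z2 z1.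
rewrite (normcBC _ z2) in h2.
have n1 := normc_ge0 _ z1; have n2 := normc_ge0 _ z2.
apply: ler_pM => //; first by rewrite ler_norml; apply/andP; split; lra.
by rewrite ger0_norm; lra.
Qed.

(** Stability of the Gaussian, which makes the zero order terms cancel in [Dm]. *)
Lemma psi0_scale (j : nat) (t : R) : psi0 (t / Num.sqrt j.+1%:R) ^+ j.+1 = psi0 t.
Proof.
rewrite /psi0 -expRM_natl; congr expR.
rewrite mulrN exprMn exprVn sqr_sqrtr//.
have : j.+1%:R != 0 :> R by rewrite pnatr_eq0.
by move: (j.+1%:R) => N N0; field.
Qed.

Lemma norm_scale (j : nat) (t T : R) : `|t| <= T -> `|t / Num.sqrt j.+1%:R| <= T.
Proof.
move=> tT; rewrite (le_trans _ tT)// normrM ler_piMr// ger0_norm ?invr_ge0//.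
by rewrite invf_le1 ?sqrtr_gt0// -[leLHS]sqrtr1 ler_wsqrtr// ler1n.
Qed.

(** [Hm] is the difference of two consecutive instances, each matching one [Sm]. *)
Definition HmTerm (mu sigma : R) (g : R -> R[i]) (y1 y2 : R) (j : nat) (t : R) : R[i] :=
  j%:R * (G0 mu sigma g y1 y2 (t / Num.sqrt j%:R) / RtoC (psi0 (t / Num.sqrt j%:R))).

(** The right-hand side is the derivative of z^(j+1) applied to [G0], as the delta method predicts.
    It contains no division, so bounds are immediate. *)
Lemma psi0_HmTerm mu sigma (g : R -> R[i]) y1 y2 j t :
  RtoC (psi0 t) * HmTerm mu sigma g y1 y2 j.+1 t =
  j.+1%:R * RtoC (psi0 (t / Num.sqrt j.+1%:R)) ^+ j
    * G0 mu sigma g y1 y2 (t / Num.sqrt j.+1%:R).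
Proof.
rewrite /HmTerm -[in RtoC (psi0 t)](psi0_scale j) RtoCX; set p := RtoC _.
have p0 : p != 0 by rewrite RtoC_eq0 gt_eqF// psi0_gt0.
by rewrite exprS; field.
Qed.

Lemma normc_psi0_HmTerm mu sigma T K (g : R -> R[i]) y1 y2 j t :
  0 < sigma -> (forall s, `|s| <= T / sigma -> normc (g s) <= K) ->
  `|y1| <= K -> `|y2| <= K -> `|t| <= T ->
  normc (RtoC (psi0 t) * HmTerm mu sigma g y1 y2 j.+1 t)
    <= j.+1%:R * ((1 + T / sigma + T ^+ 2 / sigma) * K).
Proof.
move=> s0 gK y1K y2K tT; rewrite psi0_HmTerm !normcM normc_natr -mulrA ler_wpM2l//.
rewrite normcX normc_RtoC -[leRHS]mul1r ler_pM ?normc_ge0//.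
- by rewrite exprn_ile1// ger0_norm ?psi0_ge0// psi0_le1.
- by apply: normc_G0 => //; exact: norm_scale.
Qed.

Lemma Sm_linearization (mu sigma T K : R) j : 0 < sigma -> 0 <= T -> 0 <= K ->
  exists2 C, 0 <= C & forall n x eta delta, (0 < n)%N ->
    let h := (Num.sqrt n%:R)^-1 in
    h <= 1 -> h * K <= sigma / 2 -> C * h < delta -> 0 <= eta ->
    tame _ (T / sigma) K eta delta
      (Zn _ mu sigma n x) (Un _ mu n x) (Vn _ sigma n x) ->
    forall t, `|t| <= T ->
    let r := normc (RtoC h^-1 * (Sm n x j.+1 t - RtoC (psi0 t)) - RtoC (psi0 t) *
       HmTerm mu sigma (Zn _ mu sigma n x) (Un _ mu n x) (Vn _ sigma n x) j.+1 t) in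
    r <= C /\ (`|t| <= T / sigma * ssdev n x -> r <= C * (h + eta)).
Proof.
move=> s0 T0 K0; have [C C0 lin] := secf_linearization _ mu sigma T K s0 T0 K0.
pose CG := (1 + T / sigma + T ^+ 2 / sigma) * K.
have CG0 : 0 <= CG.
  by rewrite mulr_ge0// !addr_ge0 ?mulr_ge0 ?exprn_ge0// invr_ge0 ltW.
have j0 : 1 <= j.+1%:R :> R by rewrite ler1n.
pose B := j.+1%:R ^+ 2 * (CG + C) ^+ 2.
have B0 : 0 <= B by apply: mulr_ge0; exact: sqr_ge0.
have jC : C <= j.+1%:R * C by rewrite ler_peMl.
(* [B] is the second order remainder of the power, the middle term the error of [secf], and the last
   one multiplies eta. *)
exists (B + j.+1%:R * C + j.+1%:R); first by clearbody B; lra.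
move=> n x eta delta n0 /=; set h := _^-1 => h1 hK hd eta0 tm t tT.
have hp : 0 < h by rewrite invr_gt0 sqrtn_gt0.
have h0 := ltW hp.
have hdC : C * h < delta.
  by apply: le_lt_trans hd; rewrite ler_wpM2r//; clearbody B; lra.
have uT := norm_scale j t T tT; set u := t / _ in uT *.
have [/= r1 r2] := lin n x eta delta n0 h1 hK hdC tm u uT.
rewrite psi0_HmTerm -/u.
case: tm => UK VK ZK _; have GK := normc_G0 _ mu sigma T K _ _ _ u s0 ZK UK VK uT.
rewrite -/h -/CG in r1 r2 GK *; set g := G0 _ _ _ _ _ _ in r1 r2 GK *.
set f := secf n x u in r1 r2 *; set p := RtoC (psi0 u) in r1 r2 *.
have E : RtoC h^-1 * (Sm n x j.+1 t - RtoC (psi0 t)) - j.+1%:R * p ^+ j * g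
  = RtoC h^-1 * ((f ^+ j.+1 - p ^+ j.+1 - j.+1%:R * p ^+ j * (f - p))
     + j.+1%:R * p ^+ j * (f - p - RtoC h * g)).
  rewrite /Sm -/u -/f -(psi0_scale j t) RtoCX -/u -/p.
  have -> : j.+1%:R * p ^+ j * g = RtoC h^-1 * (j.+1%:R * p ^+ j * (RtoC h * g)).
    rewrite -[g in LHS]mul1r -RtoC1 -(mulVf (lt0r_neq0 hp)) RtoCM; ring.
  by ring.
rewrite {}E normcM normc_RtoC ger0_norm ?invr_ge0//.
have f1 : normc f <= 1 by exact: normc_secf_le1.
have p1 : normc p <= 1 by rewrite normc_RtoC ger0_norm ?psi0_ge0// psi0_le1.
set r := normc (f - p - _) in r1 r2 *.
have fp : normc (f - p) <= h * (CG + C).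
  have := le_normc_dist _ (f - p) (RtoC h * g); rewrite -/r normcM normc_RtoC ger0_norm//.
  have := ler_wpM2l h0 GK; rewrite mulrDr; lra.
set q := normc _.
have qE : q <= B * h ^+ 2 + j.+1%:R * r.
  apply: (le_trans (le_normcD _ _)); apply: lerD.
    apply: (le_trans (pow_linearization _ _ _ _ f1 p1)); rewrite /B -mulrA ler_wpM2l ?sqr_ge0//.
    by rewrite -exprMn mulrC lerXn2r ?nnegrE ?normc_ge0// mulr_ge0// addr_ge0.
  rewrite !normcM normc_natr ler_wpM2r ?normc_ge0// ler_piMr// normcX.
  by rewrite exprn_ile1 ?normc_ge0.
rewrite !ler_pdivrMl//.
have rj c : r <= h * c -> q <= h * (B * h + j.+1%:R * c).
  move=> rc; apply: (le_trans qE).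
  rewrite mulrDr expr2 mulrCA lerD// [h * _]mulrCA ler_wpM2l//.
split=> [|tS].
  apply: (le_trans (rj _ r1)); rewrite ler_wpM2l//.
  have : B * h <= B by rewrite ler_piMr.
  lra.
have uS : `|u| <= T / sigma * ssdev n x.
  exact: norm_scale.
apply: (le_trans (rj _ (r2 uS))); rewrite ler_wpM2l//.
have : 0 <= (B + j.+1%:R * C) * eta + j.+1%:R * h.
  by clearbody B; rewrite addr_ge0 ?mulr_ge0// addr_ge0// mulr_ge0.
lra.
Qed.

Lemma nDelta_Qm_dist (mu sigma T K beta : R) m : 0 < sigma -> 0 <= T -> 0 <= K ->
  0 <= beta ->
  exists2 C, 0 <= C & forall n x eta delta, (0 < n)%N ->
    let h := (Num.sqrt n%:R)^-1 in
    h <= 1 -> h * K <= sigma / 2 -> C * h < delta -> 0 <= eta <= 1 ->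
    tame _ (T / sigma) K eta delta
      (Zn _ mu sigma n x) (Un _ mu n x) (Vn _ sigma n x) ->
    let w := fun t : R => expR (- (beta * t ^+ 2)) in
    let Q := Qm w T mu sigma (Zn _ mu sigma n x) (Un _ mu n x) (Vn _ sigma n x) m.+1 in
    `|n%:R * Delta w T n x m.+1 - Q| <= C * (h + eta) /\ `|Q| <= C.
Proof.
move=> s0 T0 K0 beta0.
have [C1 C10 lin1] := Sm_linearization mu sigma T K m s0 T0 K0.
have [C2 C20 lin2] := Sm_linearization mu sigma T K m.+1 s0 T0 K0.
pose CG := (1 + T / sigma + T ^+ 2 / sigma) * K.
have si : 0 <= sigma^-1 by rewrite invr_ge0 ltW.
have CG0 : 0 <= CG by rewrite mulr_ge0// !addr_ge0 ?mulr_ge0 ?exprn_ge0.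
pose B := m.+2%:R * CG + m.+1%:R * CG.
have B0 : 0 <= B by rewrite addr_ge0// mulr_ge0.
(* The shape of [normsq_dist]: C1 + C2 will bound the difference of the two rescaled integrands
   before squaring, and [B] the limiting one. *)
pose C3 := (C1 + C2) * (C1 + C2 + 2 * B).
have C30 : 0 <= C3 by rewrite mulr_ge0 ?addr_ge0// mulr_ge0.
pose C4 := 2 * T * C3 + 2 * (T * K / sigma) * C3.
have C40 : 0 <= C4.
  by clearbody C3; rewrite addr_ge0 ?mulr_ge0.
have TB : 0 <= 2 * T * B ^+ 2 by apply: mulr_ge0; [rewrite mulr_ge0|exact: sqr_ge0].
(* [C1] and [C2] pass on the condition C h < delta, [C4] bounds the difference, and the last summand
   bounds |Q|. *)
exists (C1 + C2 + C4 + 2 * T * B ^+ 2).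
  by clearbody C4 B; rewrite !addr_ge0.
move=> n x eta delta n0 /=; set h := _^-1 => h1 hK hd /andP[eta0 eta1] tm.
have hp : 0 < h by rewrite invr_gt0 sqrtn_gt0.
have h0 := ltW hp.
have hd1 : C1 * h < delta by apply: le_lt_trans hd; rewrite ler_wpM2r//; lra.
have hd2 : C2 * h < delta by apply: le_lt_trans hd; rewrite ler_wpM2r//; lra.
have := lin1 n x eta delta n0 h1 hK hd1 eta0 tm.
have := lin2 n x eta delta n0 h1 hK hd2 eta0 tm => {lin1 lin2 hd hd1 hd2} /= lin2 lin1.
case: tm => UK VK ZK _; set w := fun t : R => _.
set Z := Zn _ mu sigma n x in ZK lin1 lin2 *.
set U := Un _ mu n x in UK lin1 lin2 *; set V := Vn _ sigma n x in VK lin1 lin2 *.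
rewrite -/h in lin1 lin2.
have w01 t : 0 <= w t <= 1.
  rewrite /w expR_ge0 expR_le1 oppr_le0 mulr_ge0//; exact: sqr_ge0.
have HmE t : Hm mu sigma Z U V m.+1 t = HmTerm mu sigma Z U V m.+2 t - HmTerm mu sigma Z U V m.+1 t.
  by [].
(* As h^-1 = sqrt n, the integrands of n [Delta] and [Qm] become w |a|^2 and w |b|^2, and the
   linearizations of the two [Sm] bound a - b. *)
pose b t := RtoC (psi0 t) * Hm mu sigma Z U V m.+1 t.
pose a t := RtoC h^-1 * Dm n x m.+1 t.
have bB t : `|t| <= T -> normc (b t) <= B.
  move=> tT; rewrite /b HmE mulrBr (le_trans (le_normcB _ _ _))// lerD//.
    exact: normc_psi0_HmTerm.
  exact: normc_psi0_HmTerm.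
have abE t : a t - b t =
    (RtoC h^-1 * (Sm n x m.+2 t - RtoC (psi0 t)) - RtoC (psi0 t) * HmTerm mu sigma Z U V m.+2 t)
  - (RtoC h^-1 * (Sm n x m.+1 t - RtoC (psi0 t)) - RtoC (psi0 t) * HmTerm mu sigma Z U V m.+1 t).
  by rewrite /a /b HmE /Dm; ring.
have ab1 t : `|t| <= T -> normc (a t - b t) <= C1 + C2.
  move=> tT; rewrite abE (le_trans (le_normcB _ _ _))// addrC lerD//.
    by have [] := lin1 t tT.
  by have [] := lin2 t tT.
have ab2 t : `|t| <= T -> `|t| <= T / sigma * ssdev n x ->
    normc (a t - b t) <= (C1 + C2) * (h + eta).
  move=> tT tS; rewrite abE (le_trans (le_normcB _ _ _))// addrC mulrDl lerD//.
    by have [_ ->] := lin1 t tT.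
  by have [_ ->] := lin2 t tT.
have bE t : w t * psi0 t ^+ 2 * normsq (Hm mu sigma Z U V m.+1 t) = w t * normsq (b t).
  rewrite -mulrA; congr (_ * _).
  by rewrite /b !normsqE normcM normc_RtoC exprMn real_normK ?num_real.
have aE t : n%:R * (w t * normsq (Dm n x m.+1 t)) = w t * normsq (a t).
  rewrite mulrCA; congr (_ * _).
  by rewrite /a !normsqE normcM normc_RtoC exprMn real_normK ?num_real// invrK sqr_sqrtr.
have mb : measurable_fun setT (fun t => w t * normsq (b t)).
  apply: measurable_funM; first exact: (measurable_expRN_sqr _ _ _ beta (fun t => t)).
  apply: measurable_normsq; apply: measurableC_M.
    by apply: measurableC_RtoC; exact: (measurable_psi0 _ _ _ (fun t => t)).
  apply: (measurableC_Hm _ _ _ mu sigma (fun=> Z) (fun=> U) (fun=> V) m.+1 (fun t => t)) => // f' mf'.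
  exact: (measurableC_Zn _ _ _ mu sigma n (fun k _ => x k)).
have mD : measurableC_fun _ _ _ (Dm n x m.+1).
  exact: (measurableC_Dm _ _ _ n (fun k _ => x k) m.+1 (fun t => t)).
have ma : measurable_fun setT (fun t => w t * normsq (a t)).
  apply: measurable_funM; first exact: (measurable_expRN_sqr _ _ _ beta (fun t => t)).
  apply: measurable_normsq; apply: measurableC_M => //.
have bM t : `|t| <= T -> `|w t * normsq (b t)| <= B ^+ 2.
  move=> tT; have /andP[w0 w1] := w01 t.
  rewrite ger0_norm ?mulr_ge0 ?normsq_ge0// -[leRHS]mul1r ler_pM ?normsq_ge0//.
  by rewrite normsqE lerXn2r ?nnegrE ?normc_ge0// bB.
have abM t c : `|t| <= T -> normc (a t - b t) <= (C1 + C2) * c ->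
    `|w t * normsq (a t) - w t * normsq (b t)| <= C3 * c.
  move=> tT abc; have /andP[w0 w1] := w01 t.
  rewrite -mulrBr normrM (ger0_norm w0) -[leRHS]mul1r ler_pM//.
  rewrite (le_trans (normsq_dist _ _))// /C3 mulrAC ler_pM ?normc_ge0//.
    by rewrite addr_ge0 ?mulr_ge0 ?normc_ge0.
  by rewrite lerD ?ab1// ler_wpM2l// bB.
have QE : Qm w T mu sigma Z U V m.+1 = \int[leb]_(t in `[- T, T]) (w t * normsq (b t)).
  by apply: eq_Rintegral => t _; rewrite bE.
have DE : n%:R * Delta w T n x m.+1 = \int[leb]_(t in `[- T, T]) (w t * normsq (a t)).
  rewrite /Delta -RintegralZl//; first by apply: eq_Rintegral => t _; rewrite aE.
  apply: (integrable_bounded_itv T (2 ^+ 2)).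
    apply: measurable_funM; first exact: (measurable_expRN_sqr _ _ _ beta (fun t => t)).
    exact: measurable_normsq.
  move=> t tT; have /andP[w0 w1] := w01 t.
  rewrite ger0_norm ?mulr_ge0 ?normsq_ge0// -[leRHS]mul1r ler_pM ?normsq_ge0//.
  rewrite normsqE lerXn2r ?nnegrE ?normc_ge0// (le_trans (le_normcB _ _ _))//.
  by rewrite (_ : 2 = 1 + 1 :> R)// lerD// normcX exprn_ile1 ?normc_ge0 ?normc_secf_le1.
rewrite DE QE; split.
  (* If |t| <= T - e, then |t| <= (T / sigma) (sigma - h K) <= (T / sigma) S, the range of the sharp
     estimate. *)
  pose e := T * K / sigma * h.
  have eT : 0 <= e <= T.
    rewrite /e; apply/andP; split; first by rewrite !mulr_ge0.
    have -> : T * K / sigma * h = T * (h * K / sigma) by ring.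
    by rewrite ler_piMr// ler_pdivrMr// mul1r (le_trans hK)//; lra.
  have he0 : 0 <= C3 * (h + eta) by rewrite mulr_ge0// addr_ge0.
  apply: (le_trans (Rintegral_dist_le T e (C3 * (h + eta)) C3 (B ^+ 2) _ _ eT he0 C30 ma mb bM _ _)).
  - by move=> t tT; rewrite -[C3]mulr1 abM// mulr1 ab1.
  - move=> t tTe; have tT : `|t| <= T by rewrite (le_trans tTe)//; lra.
    apply: abM => //; apply: ab2 => //; rewrite (le_trans tTe)//.
    rewrite (ssdev_Vn _ sigma n x n0) -/h -/V /e mulrDr divfK ?gt_eqF// lerD2l.
    have -> : T * K / sigma * h = T / sigma * (h * K) by ring.
    rewrite -mulrN ler_wpM2l ?mulr_ge0// -mulrN ler_wpM2l//.
    by rewrite lerNl (le_trans (ler_norm _))// normrN.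
  - have k1 : 0 <= 2 * (T * K / sigma) * C3 by clearbody C3; rewrite !mulr_ge0.
    have k2 := mulr_ge0 k1 eta0.
    have k3 : 0 <= (C1 + C2 + 2 * T * B ^+ 2) * (h + eta).
      by clearbody B; rewrite mulr_ge0 ?addr_ge0.
    rewrite /e /C4; lra.
rewrite (le_trans (le_normr_Rintegral _ (integrable_bounded_itv T (B ^+ 2) _ mb bM)))//.
apply: (@le_trans _ _ (\int[leb]_(t in `[- T, T]) (B ^+ 2))).
  apply: le_Rintegral => //.
  - apply: (integrable_bounded_itv T (B ^+ 2)); first exact: measurableT_comp.
    by move=> t tT; rewrite normr_id bM.
  - by apply: (integrable_bounded_itv T (B ^+ 2)) => // t _; rewrite ger0_norm ?sqr_ge0.
  - by move=> t /=; rewrite in_itv/= -ler_norml => tT; exact: bM.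
rewrite Rintegral_cst_itv//.
have : 0 <= C1 + C2 + C4 by clearbody C4; rewrite !addr_ge0.
lra.
Qed.

End comparison.

(** * Continuity of Q_m *)

Section lower_integral.
Local Open Scope ereal_scope.
Context d (S : measurableType d) (R : realType) (mu : {measure set S -> \bar R}).
Import HBNNSimple.

(* On a nonnegative function the library integral is a supremum over simple
   functions below it, so these two inequalities need no measurability. *)
Lemma ge0_le_lower_integral (D : set S) (f g : S -> \bar R) :
  (forall x, D x -> 0 <= f x) -> (forall x, D x -> f x <= g x) ->
  \int[mu]_(x in D) f x <= \int[mu]_(x in D) g x.
Proof.
move=> f0 fg; have g0 x : D x -> 0 <= g x.
  by move=> Dx; exact: le_trans (f0 _ Dx) (fg _ Dx).
rewrite ge0_integralE// ge0_integralE//; apply: le_ereal_sup.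
move=> _ [h /= hf <-]; exists h => //= x; apply: (le_trans (hf x)).
by rewrite !patchE; case: ifPn => // /set_mem; exact: fg.
Qed.

Lemma le_lower_integral (D : set S) (c e : R) (f g : S -> R) : measurable D ->
  (0 < c)%R -> (0 <= e)%R ->
  (forall x, D x -> 0 <= f x)%R -> (forall x, D x -> 0 <= g x)%R ->
  (forall x, D x -> f x <= c * g x + e)%R ->
  \int[mu]_(x in D) (f x)%:E <= c%:E * \int[mu]_(x in D) (g x)%:E + e%:E * mu D.
Proof.
move=> mD c0 e0 f0 g0 fg; rewrite [leLHS]ge0_integralE//; apply: ge_ereal_sup.
move=> _ [h /= hf <-].
(* A measurable minorant of [g] with h <= c k + e, made from the simple function [h] below [f];
   additivity is then used for measurable functions only. *)
pose k x := Num.max 0%R ((h x - e) / c)%R.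
have k0 x : (0 <= k x)%R by rewrite le_max lexx.
have mk : measurable_fun D k.
  apply: measurable_maxr => //; apply: measurable_funM => //.
  by apply: measurable_funB => //; exact: measurable_funTS.
have hD x : ~ D x -> h x = 0%R.
  move=> nDx; apply/eqP; rewrite eq_le fun_ge0 andbT -lee_fin.
  by rewrite (le_trans (hf x))// patchE memNset.
rewrite -integralT_nnsfun (_ : \int[mu]_x (h x)%:E = \int[mu]_(x in D) (h x)%:E); last first.
  rewrite [RHS]integral_mkcond; apply: eq_integral => x _; rewrite patchE.
  by case: ifPn => // /negP; rewrite inE => /hD ->.
apply: (@le_trans _ _ (\int[mu]_(x in D) (c%:E * (k x)%:E + e%:E))).
  apply: ge0_le_lower_integral => x Dx; first by rewrite lee_fin.
  rewrite -EFinM -EFinD lee_fin -lerBlDr -ler_pdivrMl// mulrC.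
  by rewrite /k le_max lexx orbT.
have ck0 x : D x -> 0 <= c%:E * (k x)%:E by move=> _; rewrite mule_ge0// lee_fin// ltW.
have mck : measurable_fun D (fun x => c%:E * (k x)%:E).
  by apply: emeasurable_funM => //; exact/measurable_EFinP.
have e0' x : D x -> 0 <= e%:E by move=> _; rewrite lee_fin.
have k0' x : D x -> 0 <= (k x)%:E by move=> _; rewrite lee_fin.
have mk' : measurable_fun D (EFin \o k) by exact/measurable_EFinP.
rewrite (ge0_integralD _ mD ck0 mck e0')// integral_cst// leeD2r//.
rewrite (ge0_integralZl_EFin _ mD k0' mk' (ltW c0)).
apply: lee_wpmul2l; first by rewrite lee_fin ltW.
apply: ge0_le_lower_integral => x Dx.
  by rewrite lee_fin.
rewrite lee_fin ge_max g0//= ler_pdivrMr// lerBlDr mulrC (le_trans _ (fg x Dx))//.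
by have := hf x; rewrite patchE mem_set.
Qed.

End lower_integral.

(** The symmetric bounds force I and J to be finite or infinite together, and in the infinite case
    [fine] sends both to 0. Otherwise the first bound is inserted into the second, with d <= 1. *)
Lemma fine_dist_le (R : realType) (I J : \bar R) (d c : R) :
  (0 <= I)%E -> (0 <= J)%E -> 0 <= d <= 1 -> 0 <= c ->
  (J <= (1 + d)%:E * I + (c * d)%:E)%E -> (I <= (1 + d)%:E * J + (c * d)%:E)%E ->
  `|fine J - fine I| <= d * (2 * fine I + 2 * c).
Proof.
case: I => [I| |]//; case: J => [J| |]//=.
- rewrite -!EFinM -!EFinD !lee_fin => I0 J0 /andP[d0 d1] c0 h1 h2.
  rewrite ler_norml; apply/andP; split; nra.
- move=> _ _ /andP[d0 _] c0 _ _; rewrite subrr normr0 mulr_ge0// mulr0 add0r.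
  by rewrite mulr_ge0.
Qed.

Section Qm_continuity.
Variable R : realType.
Local Notation leb := (@lebesgue_measure R).

(** Linearity in the triple turns the size bound [normc_psi0_HmTerm] into a Lipschitz bound. *)
Lemma HmTerm_B (mu sigma : R) (g g' : R -> R[i]) y1 y1' y2 y2' j t :
  HmTerm _ mu sigma g' y1' y2' j t - HmTerm _ mu sigma g y1 y2 j t =
  HmTerm _ mu sigma (fun s => g' s - g s) (y1' - y1) (y2' - y2) j t.
Proof. by rewrite /HmTerm /G0 !(mulrBr, RtoCB); ring. Qed.

(** For an arbitrary path the integrand may be unbounded, so the cross term of the square admits no
    uniform additive bound. Young's inequality absorbs it into a factor 1 + d, and the resulting
    estimate [key] can be used in both directions. *)
Lemma Qm_continuous (mu sigma T beta : R) (m : nat) (g : R -> R[i]) (y1 y2 : R) :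
  0 < sigma -> 0 <= T -> 0 <= beta ->
  let w := fun t : R => expR (- (beta * t ^+ 2)) in
  forall e : R, 0 < e -> exists2 d : R, 0 < d & forall g' y1' y2',
    (forall s, `|s| <= T / sigma -> normc (g' s - g s) < d) ->
    `|y1' - y1| < d -> `|y2' - y2| < d ->
    `|Qm w T mu sigma g' y1' y2' m.+1 - Qm w T mu sigma g y1 y2 m.+1| < e.
Proof.
move=> s0 T0 beta0 w e e0.
have w01 t : 0 <= w t <= 1.
  rewrite /w expR_ge0 expR_le1 oppr_le0 mulr_ge0//; exact: sqr_ge0.
pose b g y1 y2 t := RtoC (psi0 t) * Hm mu sigma g y1 y2 m.+1 t.
pose I g y1 y2 := (\int[leb]_(t in `[(- T)%R, T]) (w t * normsq (b g y1 y2 t))%:E)%E.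
have QE g' z1 z2 : Qm w T mu sigma g' z1 z2 m.+1 = fine (I g' z1 z2).
  congr fine; apply: eq_integral => t _; rewrite -mulrA; congr (_ * _)%:E.
  by rewrite /b !normsqE normcM normc_RtoC exprMn real_normK ?num_real.
have I0 g' z1 z2 : (0 <= I g' z1 z2)%E.
  apply: integral_ge0 => t _; rewrite lee_fin mulr_ge0 ?normsq_ge0//.
  by case/andP: (w01 t).
pose CG := 1 + T / sigma + T ^+ 2 / sigma.
have CG0 : 0 <= CG.
  by rewrite !addr_ge0 ?mulr_ge0 ?exprn_ge0// invr_ge0 ltW.
pose B := m.+2%:R * CG + m.+1%:R * CG.
have B0 : 0 <= B by rewrite addr_ge0// mulr_ge0.
(* One B^2 from the cross term and one from the squared increment, times the length of the
   interval. *)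
pose c := 2 * B ^+ 2 * (2 * T).
have c0 : 0 <= c by rewrite mulr_ge0 ?mulr_ge0 ?exprn_ge0.
have key g1 g2 z1 z1' z2 z2' d : 0 < d <= 1 ->
    (forall s, `|s| <= T / sigma -> normc (g2 s - g1 s) <= d) ->
    `|z1' - z1| <= d -> `|z2' - z2| <= d ->
    (I g2 z1' z2' <= (1 + d)%:E * I g1 z1 z2 + (c * d)%:E)%E.
  move=> /andP[d0 d1] gd h1 h2.
  have bd t : `|t| <= T -> normc (b g2 z1' z2' t - b g1 z1 z2 t) <= B * d.
    move=> tT.
    have -> : b g2 z1' z2' t - b g1 z1 z2 t =
        RtoC (psi0 t) * HmTerm _ mu sigma (fun s => g2 s - g1 s) (z1' - z1) (z2' - z2) m.+2 t
      - RtoC (psi0 t) * HmTerm _ mu sigma (fun s => g2 s - g1 s) (z1' - z1) (z2' - z2) m.+1 t.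
      by rewrite -!HmTerm_B /b /Hm -/(HmTerm _ mu sigma g2 z1' z2' m.+2 t)
        -/(HmTerm _ mu sigma g2 z1' z2' m.+1 t) -/(HmTerm _ mu sigma g1 z1 z2 m.+2 t)
        -/(HmTerm _ mu sigma g1 z1 z2 m.+1 t); ring.
    rewrite (le_trans (le_normcB _ _ _))// mulrDl lerD// -mulrA; exact: normc_psi0_HmTerm.
  have e'0 : 0 <= 2 * B ^+ 2 * d by rewrite mulr_ge0 ?(ltW d0)// mulr_ge0// exprn_ge0.
  have d10 : 0 < 1 + d by rewrite addr_gt0.
  have TT : - T <= T by lra.
  have -> : (c * d)%:E = ((2 * B ^+ 2 * d)%:E * leb `[(- T)%R, T]%classic)%E.
    by rewrite lebesgue_itvcc// -EFinM; congr (_%:E); rewrite /c; ring.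
  apply: le_lower_integral => //.
  - by move=> t _; rewrite mulr_ge0 ?normsq_ge0//; case/andP: (w01 t).
  - by move=> t _; rewrite mulr_ge0 ?normsq_ge0//; case/andP: (w01 t).
  move=> t /=; rewrite in_itv/= -ler_norml => tT.
  case/andP: (w01 t) => w0 w1.
  apply: (@le_trans _ _ (w t * ((1 + d) * normsq (b g1 z1 z2 t) + 2 * B ^+ 2 * d))); last first.
    by rewrite mulrDr [w t * ((1 + d) * _)]mulrCA lerD2l ler_piMl.
  rewrite ler_wpM2l// !normsqE.
  have := le_normc_dist _ (b g2 z1' z2' t) (b g1 z1 z2 t).
  have := bd t tT; have := normc_ge0 _ (b g2 z1' z2' t); have := normc_ge0 _ (b g1 z1 z2 t).
  move: (normc (b g2 _ _ _)) (normc (b g1 _ _ _)) (normc (_ - _)) => y x z x0 y0 zB yx.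
  have yxB : y <= x + B * d by lra.
  apply: (@le_trans _ _ ((x + B * d) ^+ 2)); first by rewrite lerXn2r ?nnegrE// (le_trans y0).
  (* [2 x (B d) <= d x^2 + d B^2] *)
  have : 0 <= d * (x - B) ^+ 2 by rewrite mulr_ge0 ?sqr_ge0 ?(ltW d0).
  have : (B * d) ^+ 2 <= B ^+ 2 * d.
    by rewrite exprMn ler_wpM2l ?sqr_ge0// expr2 ler_piMl ?(ltW d0).
  move=> k1 k2; nra.
pose F := 2 * fine (I g y1 y2) + 2 * c.
have F0 : 0 <= F by rewrite addr_ge0 ?mulr_ge0// fine_ge0.
pose d := Num.min 1 (e / (F + 1)).
have d0 : 0 < d by rewrite lt_min ltr01 divr_gt0// ltr_wpDl.
have d1 : d <= 1 by rewrite ge_min lexx.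
exists d => // g' y1' y2' gd h1 h2; rewrite !QE.
apply: (@le_lt_trans _ _ (d * F)).
  apply: fine_dist_le => //.
  - by rewrite ltW.
  - by apply: key; [rewrite d0|move=> s sT; exact/ltW/gd|exact: ltW|exact: ltW].
  - apply: key; [by rewrite d0|move=> s sT|by rewrite distrC ltW|by rewrite distrC ltW].
    by rewrite normcBC; exact/ltW/gd.
apply: (@le_lt_trans _ _ (e / (F + 1) * F)).
  by rewrite ler_wpM2r// ge_min lexx orbT.
by rewrite mulrAC ltr_pdivrMr ?ltr_wpDl// ltr_pM2l// ltrDl.
Qed.

End Qm_continuity.

(** * Tightness *)

Section uniform_continuity.
Variable R : realType.

(** Heine-Cantor with only [v] confined to the box, which the covering form of compactness allows.
    In the application [v] is the bounded vector of the Q_m and [v'] is n [Delta]. *)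
Lemma row_uniform_continuity M (f : 'rV[R]_M -> R) (B e : R) :
  continuous f -> 0 < e -> exists2 d : R, 0 < d &
    forall v v' : 'rV[R]_M, (forall i, `|v ord0 i| <= B) ->
      (forall i, `|v' ord0 i - v ord0 i| < d) -> `|f v' - f v| < e.
Proof.
move=> cf e0.
pose A := [set v : 'rV[R]_M | forall i, `[- B, B]%classic (v ord0 i)].
have cA : compact A by apply: (@rV_compact R M (fun=> `[- B, B]%classic)) => i; exact: segment_compact.
pose Q (d : R) (v : 'rV[R]_M) := forall v' : 'rV[R]_M,
  (forall i, `|v' ord0 i - v ord0 i| < d) -> `|f v' - f v| < e.
have : \forall d \near 0^'+, A `<=` Q d.
  apply: (compact_near_coveringP A).1 => // x _.
  have /cvgrPdist_lt/(_ (e / 2)) := cf x; rewrite divr_gt0// => /(_ isT).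
  move=> /nbhs_ballP[r /= r0 rP].
  exists (ball x (r / 2), [set d | d < r / 2]) => /=.
    split; first by apply: nbhsx_ballx; rewrite divr_gt0.
    by apply: nbhs_right_lt; rewrite divr_gt0.
  move=> [x' d] [/= xx' dr] v' v'x'.
  have h1 : `|f x - f x'| < e / 2.
    apply: rP; apply: le_ball xx'; lra.
  have h2 : `|f x - f v'| < e / 2.
    apply: rP; split => // i j; rewrite /ball /= ord1.
    have := xx'.2 ord0 j; rewrite /ball /= => k1; have k2 := v'x' j.
    rewrite (splitr r) -(subrKA (x' ord0 j)) (le_lt_trans (ler_normD _ _))// ltrD//.
    by rewrite distrC (lt_trans k2).
  rewrite (splitr e) -(subrKA (f x)) (le_lt_trans (ler_normD _ _))// ltrD//.
  by rewrite distrC.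
move=> near_d; have [d [d0 dA]] := filter_ex (filterI (nbhs_right_gt (0 : R)) near_d).
exists d => // v v' vB vv'; apply: dA => // i /=.
by rewrite in_itv/= -ler_norml.
Qed.

Lemma contC_on_uniform (a e : R) (g : R -> R[i]) : contC_on a g -> 0 < e ->
  exists2 d, 0 < d & forall s s', `|s| <= a -> `|s'| <= a -> `|s' - s| < d ->
    normc (g s' - g s) < e.
Proof.
move=> cg e0; pose A := `[- a, a]%classic : set R.
have cA : compact A by exact: segment_compact.
pose Q (d : R) (s : R) := `|s| <= a -> forall s', `|s'| <= a -> `|s' - s| < d ->
    normc (g s' - g s) < e.
have : \forall d \near 0^'+, A `<=` Q d.
  apply: (compact_near_coveringP A).1 => // x; rewrite /A/= in_itv/= => xa.
  have e2 : 0 < e / 2 by rewrite divr_gt0.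
  have [r r0 rP] := cg x xa _ e2.
  exists (ball x (r / 2), [set d | d < r / 2]) => /=.
    split; first by apply: nbhsx_ballx; rewrite divr_gt0.
    by apply: nbhs_right_lt; rewrite divr_gt0.
  move=> [x' d] [/= xx' dr] x'a v' v'a v'x'; rewrite /ball/= in xx'.
  have h1 : normc (g x' - g x) < e / 2.
    by rewrite -sqrt_normsq; apply: rP; [rewrite -ler_norml|rewrite distrC (lt_le_trans xx')//; lra].
  have h2 : normc (g v' - g x) < e / 2.
    rewrite -sqrt_normsq; apply: rP; first by rewrite -ler_norml.
    rewrite (splitr r) -(subrKA x') (le_lt_trans (ler_normD _ _))// ltrD// ?(lt_trans v'x')//.
    by rewrite distrC.
  rewrite (splitr e) (le_lt_trans (le_normc_trans _ _ (g x) _))// ltrD//.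
  by rewrite normcBC.
move=> near_d; have [d [d0 dA]] := filter_ex (filterI (nbhs_right_gt (0 : R)) near_d).
exists d => // s s' sa s'a ss'; apply: dA => //.
by rewrite /A /= in_itv/= -ler_norml.
Qed.

Lemma contC_on_bounded (a : R) (g : R -> R[i]) : contC_on a g ->
  exists2 B, 0 <= B & forall s, `|s| <= a -> normc (g s) <= B.
Proof.
move=> cg; pose A := `[- a, a]%classic : set R.
have cA : compact A by exact: segment_compact.
pose Q (B : R) (s : R) := `|s| <= a -> normc (g s) <= B.
have : \forall B \near +oo, A `<=` Q B.
  apply: (compact_near_coveringP A).1 => // x; rewrite /A/= in_itv/= => xa.
  have [r r0 rP] := cg x xa 1 ltr01.
  exists (ball x r, [set B | normc (g x) + 1 <= B]) => /=.
    split; first exact: nbhsx_ballx.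
    by apply: nbhs_pinfty_ge; exact: num_real.
  move=> [x' B] [/= xx' xB] x'a; rewrite /ball/= in xx'.
  have h1 : normc (g x' - g x) < 1.
    by rewrite -sqrt_normsq; apply: rP; [rewrite -ler_norml|rewrite distrC].
  by rewrite (le_trans (le_normc_dist _ _ (g x)))// (le_trans _ xB)// lerD2l ltW.
move=> near_B; have [B [B0 BA]] := filter_ex (filterI (nbhs_pinfty_ge (num_real (0 : R))) near_B).
exists B => // s sa; apply: BA => //.
by rewrite /A /= in_itv/= -ler_norml.
Qed.

End uniform_continuity.

(** * A continuous functional detecting size and oscillation *)

Section tightness_functional.
Variable R : realType.
Implicit Types (a k r d : R) (g : R -> R[i]).

(** A 1-Lipschitz retraction onto [-a, a], used to bring all rationals into the interval. *)
Definition clamp a (s : R) : R := Num.max (- a) (Num.min a s).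

Lemma clamp_le a s : 0 <= a -> `|clamp a s| <= a.
Proof.
move=> a0; rewrite ler_norml /clamp le_max lexx/= ge_max ge_min lexx andbT; lra.
Qed.

Lemma clamp_id a s : `|s| <= a -> clamp a s = s.
Proof. by rewrite ler_norml => /andP[h1 h2]; rewrite /clamp min_r// max_r. Qed.

Lemma clamp_lipschitz a s t : 0 <= a -> `|clamp a s - clamp a t| <= `|s - t|.
Proof.
move=> a0; rewrite /clamp; case: (leP a s) => h1; case: (leP a t) => h2;
 case: (leP (- a) a) => h3; case: (leP (- a) s) => h4; case: (leP (- a) t) => h5;
 case: (ger0P (s - t)) => h6; rewrite ?ler_norml; lra.
Qed.

(** Enumerates all pairs of rationals; numbers that code nothing yield the harmless pair (0, 0). *)
Definition rat_pair (i : nat) : rat * rat := odflt (0, 0) (unpickle i).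

Definition pt1 a i : R := clamp a (ratr (rat_pair i).1).
(** Falling back to the first point when the pair is not d-close makes every index admissible in the
    supremum. *)
Definition pt2 a d i : R :=
  if `|pt1 a i - clamp a (ratr (rat_pair i).2)| < d
  then clamp a (ratr (rat_pair i).2) else pt1 a i.

Lemma pt1_le a i : 0 <= a -> `|pt1 a i| <= a.
Proof. exact: clamp_le. Qed.

Lemma pt2_le a d i : 0 <= a -> `|pt2 a d i| <= a.
Proof. by move=> a0; rewrite /pt2; case: ifP => _; exact: clamp_le. Qed.

Lemma pt12_dist a d i : 0 < d -> `|pt1 a i - pt2 a d i| < d.
Proof. by move=> d0; rewrite /pt2; case: ifPn => //; rewrite subrr normr0. Qed.

Lemma pt_dense a d s s' e : 0 <= a -> `|s| <= a -> `|s'| <= a -> `|s - s'| < d ->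
  0 < e -> exists i, `|pt1 a i - s| < e /\ `|pt2 a d i - s'| < e.
Proof.
move=> a0 sa s'a ss' e0.
(* The strict gap between |s - s'| and d leaves room for both approximations, so the rational pair
   is d-close too and [pt2] does not fall back. *)
pose h := Num.min e ((d - `|s - s'|) / 2).
have h0 : 0 < h by rewrite lt_min e0 divr_gt0// subr_gt0.
have he : h <= e by rewrite ge_min lexx.
have hd : h <= (d - `|s - s'|) / 2 by rewrite ge_min lexx orbT.
have near_rat t : `|t| <= a -> exists q : rat, `|clamp a (ratr q) - t| < h.
  move=> ta; have [q] : exists q : rat, ratr q \in `]t, t + h[.
    by apply: rat_in_itvoo; rewrite ltrDl.
  rewrite in_itv/= => /andP[q1 q2]; exists q.
  rewrite -{1}(clamp_id a t ta) (le_lt_trans (clamp_lipschitz _ _ _ a0))//.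
  by rewrite ger0_norm; lra.
have [q qs] := near_rat s sa; have [q' q's'] := near_rat s' s'a.
exists (pickle (q, q')).
have E : rat_pair (pickle (q, q')) = (q, q') by rewrite /rat_pair pickleK.
rewrite /pt2 /pt1 E /= ifT; first by split; apply: lt_le_trans he.
have -> : clamp a (ratr q) - clamp a (ratr q')
   = (clamp a (ratr q) - s) + ((s - s') + (s' - clamp a (ratr q'))) by ring.
rewrite (le_lt_trans (ler_normD _ _))//.
have := ler_normD (s - s') (s' - clamp a (ratr q')).
rewrite (distrC s' (clamp a (ratr q'))).
lra.
Qed.

(** For positive k and r, a value below the cap 1 forces sizes at most 1 / k and an increment at
    most 1 / r at the sampled points. *)
Definition tau a k r d i g (y1 y2 : R) : R :=
  Num.min 1 (k * (normc (g (pt1 a i)) + `|y1| + `|y2|)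
             + r * normc (g (pt1 a i) - g (pt2 a d i))).

(* A sup-norm continuous functional controlling both size and oscillation; the
   supremum is taken over countably many points to be measurable. *)
Definition Psi a k r d g y1 y2 : R := sup (range (fun i => tau a k r d i g y1 y2)).

Section props.
Variables a k r d : R.
Hypotheses (a0 : 0 <= a) (k0 : 0 <= k) (r0 : 0 <= r) (d0 : 0 < d).

Lemma tau_ge0 i g y1 y2 : 0 <= tau a k r d i g y1 y2.
Proof.
by rewrite le_min ler01 addr_ge0// mulr_ge0 ?addr_ge0 ?normc_ge0.
Qed.

Lemma tau_le1 i g y1 y2 : tau a k r d i g y1 y2 <= 1.
Proof. by rewrite ge_min lexx. Qed.

Lemma has_sup_tau g y1 y2 : has_sup (range (fun i => tau a k r d i g y1 y2)).
Proof.
split; first by exists (tau a k r d 0 g y1 y2); exists 0%N.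
by exists 1 => _ [i _ <-]; exact: tau_le1.
Qed.

Lemma tau_le_Psi i g y1 y2 : tau a k r d i g y1 y2 <= Psi a k r d g y1 y2.
Proof. by apply: sup_upper_bound; [exact: has_sup_tau|exists i]. Qed.

Lemma Psi_le g y1 y2 c : (forall i, tau a k r d i g y1 y2 <= c) ->
  Psi a k r d g y1 y2 <= c.
Proof.
move=> h; apply: ge_sup; first by exists (tau a k r d 0 g y1 y2); exists 0%N.
by move=> _ [i _ <-].
Qed.

Lemma Psi_ge0 g y1 y2 : 0 <= Psi a k r d g y1 y2.
Proof. by rewrite (le_trans (tau_ge0 0 g y1 y2))// tau_le_Psi. Qed.

Lemma Psi_le1 g y1 y2 : Psi a k r d g y1 y2 <= 1.
Proof. by apply: Psi_le => i; exact: tau_le1. Qed.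

Lemma tau_lipschitz i g y1 y2 g' y1' y2' e :
  (forall s, `|s| <= a -> normc (g' s - g s) <= e) ->
  `|y1' - y1| <= e -> `|y2' - y2| <= e ->
  tau a k r d i g' y1' y2' <= tau a k r d i g y1 y2 + (3 * k + 2 * r) * e.
Proof.
move=> ge h1 h2.
have e0 : 0 <= e := le_trans (normr_ge0 _) h1.
have g1 := ge _ (pt1_le a i a0); have g2 := ge _ (pt2_le a d i a0).
have n1 := le_normc_dist _ (g' (pt1 a i)) (g (pt1 a i)).
have n2 : normc (g' (pt1 a i) - g' (pt2 a d i))
    <= normc (g (pt1 a i) - g (pt2 a d i)) + (e + e).
  have -> : g' (pt1 a i) - g' (pt2 a d i) = (g (pt1 a i) - g (pt2 a d i)) +
    ((g' (pt1 a i) - g (pt1 a i)) - (g' (pt2 a d i) - g (pt2 a d i))) by ring.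
  by rewrite (le_trans (le_normcD _ _))// lerD2l (le_trans (le_normcB _ _ _))// lerD.
have n3 : `|y1'| <= `|y1| + e.
  by rewrite -{1}(subrK y1 y1') addrC (le_trans (ler_normD _ _))// lerD2l.
have n4 : `|y2'| <= `|y2| + e.
  by rewrite -{1}(subrK y2 y2') addrC (le_trans (ler_normD _ _))// lerD2l.
have m0 : 0 <= (3 * k + 2 * r) * e by rewrite mulr_ge0// addr_ge0 ?mulr_ge0.
have m1 : k * (normc (g' (pt1 a i)) + `|y1'| + `|y2'|)
    <= k * (normc (g (pt1 a i)) + `|y1| + `|y2| + 3 * e).
  by rewrite ler_wpM2l//; lra.
have m2 := ler_wpM2l r0 n2.
rewrite /tau; case: (leP 1 (k * (normc (g (pt1 a i)) + _ + _) + _)) => h.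
  by rewrite (le_trans (tau_le1 i g' y1' y2'))// lerDl.
by rewrite ge_min; apply/orP; right; lra.
Qed.

Lemma Psi_lipschitz g y1 y2 g' y1' y2' e :
  (forall s, `|s| <= a -> normc (g' s - g s) <= e) ->
  `|y1' - y1| <= e -> `|y2' - y2| <= e ->
  Psi a k r d g' y1' y2' <= Psi a k r d g y1 y2 + (3 * k + 2 * r) * e.
Proof.
move=> ge h1 h2; apply: Psi_le => i.
by rewrite (le_trans (tau_lipschitz i _ _ _ _ _ _ _ ge h1 h2))// lerD2r tau_le_Psi.
Qed.

Lemma Psi_bdd_cont : bdd_cont_functional a (Psi a k r d).
Proof.
split; first by exists 1 => g y1 y2; rewrite ger0_norm ?Psi_ge0// Psi_le1.
move=> g y1 y2 e e0; pose c := 3 * k + 2 * r + 1.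
have c0 : 0 < c by rewrite ltr_wpDl// addr_ge0// mulr_ge0.
exists (e / c); first by rewrite divr_gt0.
move=> g' y1' y2' gg h1 h2.
have lt_e : (3 * k + 2 * r) * (e / c) < e.
  by rewrite mulrA ltr_pdivrMr// /c; lra.
have gg1 s : `|s| <= a -> normc (g' s - g s) <= e / c.
  by rewrite ler_norml -sqrt_normsq => /gg /ltW.
have gg2 s : `|s| <= a -> normc (g s - g' s) <= e / c by rewrite normcBC; exact: gg1.
have p1 := Psi_lipschitz _ _ _ _ _ _ _ gg1 (ltW h1) (ltW h2).
rewrite distrC in h1; rewrite distrC in h2.
have p2 := Psi_lipschitz _ _ _ _ _ _ _ gg2 (ltW h1) (ltW h2).
by rewrite ltr_norml; apply/andP; split; lra.
Qed.

(** No index reaches the cap, and continuity with density carries the bounds from the sampled points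
    to the whole interval. *)
Lemma Psi_lt1 g y1 y2 : contC_on a g -> Psi a k r d g y1 y2 < 1 ->
  [/\ k * `|y1| <= 1, k * `|y2| <= 1,
    forall s, `|s| <= a -> k * normc (g s) <= 1 &
    forall s s', `|s| <= a -> `|s'| <= a -> `|s - s'| < d ->
      r * normc (g s - g s') <= 1].
Proof.
move=> cg P1.
have lt1 i : k * (normc (g (pt1 a i)) + `|y1| + `|y2|)
             + r * normc (g (pt1 a i) - g (pt2 a d i)) < 1.
  by have := le_lt_trans (tau_le_Psi i g y1 y2) P1; rewrite gt_min ltxx.
have ge1 i : 0 <= k * normc (g (pt1 a i)) by rewrite mulr_ge0 ?normc_ge0.
have ge2 i : 0 <= r * normc (g (pt1 a i) - g (pt2 a d i)) by rewrite mulr_ge0 ?normc_ge0.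
have ge3 : 0 <= k * `|y1| by rewrite mulr_ge0.
have ge4 : 0 <= k * `|y2| by rewrite mulr_ge0.
split.
- by have := lt1 0%N; have := ge1 0%N; have := ge2 0%N; rewrite !mulrDr; lra.
- by have := lt1 0%N; have := ge1 0%N; have := ge2 0%N; rewrite !mulrDr; lra.
- move=> s sa; apply/ler_addgt0Pr => e e0.
  have e1 : 0 < e / (k + 1) by rewrite divr_gt0// ltr_wpDl.
  have [h h0 hP] := contC_on_uniform _ _ _ _ cg e1.
  have [|i [i1 _]] := pt_dense a d s s h a0 sa sa _ h0; first by rewrite subrr normr0.
  have := hP _ _ (pt1_le a i a0) sa; rewrite distrC => /(_ i1) n1.
  have n2 := le_normc_dist _ (g s) (g (pt1 a i)).
  have n3 : k * (e / (k + 1)) <= e.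
    by rewrite mulrA ler_pdivrMr ?ltr_wpDl//; lra.
  have := lt1 i; have := ge2 i; rewrite !mulrDr.
  have : k * normc (g s) <= k * normc (g (pt1 a i)) + k * (e / (k + 1)).
    by rewrite -mulrDr ler_wpM2l//; lra.
  lra.
- move=> s s' sa s'a ss'; apply/ler_addgt0Pr => e e0.
  (* r + 1 instead of r, because r = 0 is allowed and will be used. *)
  have e1 : 0 < e / (2 * (r + 1)) by rewrite divr_gt0// mulr_gt0// ltr_wpDl.
  have [h h0 hP] := contC_on_uniform _ _ _ _ cg e1.
  have [i [i1 i2]] := pt_dense a d s s' h a0 sa s'a ss' h0.
  have := hP _ _ (pt1_le a i a0) sa; rewrite distrC => /(_ i1) n1.
  have := hP _ _ s'a (pt2_le a d i a0); move=> /(_ i2) n2.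
  have n3 : r * (e / (2 * (r + 1)) + e / (2 * (r + 1))) <= e.
    have -> : r * (e / (2 * (r + 1)) + e / (2 * (r + 1))) = r * e / (r + 1).
      by field; rewrite gt_eqF// ltr_wpDl.
    by rewrite ler_pdivrMr ?ltr_wpDl//; lra.
  have n4 : normc (g s - g s') <= normc (g (pt1 a i) - g (pt2 a d i))
      + (e / (2 * (r + 1)) + e / (2 * (r + 1))).
    have -> : g s - g s' = (g (pt1 a i) - g (pt2 a d i)) +
      ((g s - g (pt1 a i)) + (g (pt2 a d i) - g s')) by ring.
    rewrite (le_trans (le_normcD _ _))// lerD2l (le_trans (le_normcD _ _))//.
    by rewrite lerD// ltW.
  have := lt1 i; have := ge1 i; have := ler_wpM2l r0 n4.
  move: n3; set z := e / (2 * (r + 1)) => n3.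
  rewrite mulrDr [k * (_ + _)]mulrDr [k * (_ + _)]mulrDr.
  move: (r * normc _) (k * normc _) (r * normc _) => x y z'.
  lra.
Qed.

Lemma measurable_Psi dd (S : measurableType dd) (g : S -> R -> R[i]) (y1 y2 : S -> R) :
  (forall s, measurableC_fun _ _ _ (fun w => g w s)) ->
  measurable_fun setT y1 -> measurable_fun setT y2 ->
  measurable_fun setT (fun w => Psi a k r d (g w) (y1 w) (y2 w)).
Proof.
move=> mg my1 my2.
have -> : (fun w => Psi a k r d (g w) (y1 w) (y2 w))
  = (fun w => sups ((fun i w => tau a k r d i (g w) (y1 w) (y2 w)) ^~ w) 0).
  apply/funext => w; rewrite /sups /Psi /=; congr sup.
  by apply/seteqP; split => x /= [i _ <-]; exists i.
apply: measurable_fun_sups => [w _|i].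
  by exists 1 => _ [i _ <-]; exact: tau_le1.
apply: measurable_minr => //; apply: measurable_funD.
  apply: measurable_funM => //; apply: measurable_funD.
    apply: measurable_funD; first exact: measurable_normc.
    exact: measurableT_comp.
  exact: measurableT_comp.
apply: measurable_funM => //; apply: measurable_normc.
exact: measurableC_B.
Qed.

End props.

(** The number 1 / (n + 1) serves both as weight k and as scale d: boundedness of [g] removes the
    size term, uniform continuity the oscillation. *)
Lemma Psi_cvg0 a r g y1 y2 : 0 <= a -> 0 <= r -> contC_on a g ->
  (fun n : nat => Psi a n.+1%:R^-1 r n.+1%:R^-1 g y1 y2) @ \oo --> (0 : R).
Proof.
move=> a0 r0 cg; apply/cvgrPdist_le => e e0.
have [B B0 BP] := contC_on_bounded _ _ _ cg.
have e1 : 0 < e / (2 * (r + 1)) by rewrite divr_gt0// mulr_gt0// ltr_wpDl.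
have [h h0 hP] := contC_on_uniform _ _ _ _ cg e1.
pose c := B + `|y1| + `|y2|.
have c0 : 0 <= c by rewrite !addr_ge0.
have e2 : 0 < Num.min h (e / (2 * (c + 1))).
  by rewrite lt_min h0 divr_gt0// mulr_gt0// ltr_wpDl.
have : \forall n \near \oo, n.+1%:R^-1 < Num.min h (e / (2 * (c + 1))).
  exact: near_infty_natSinv_lt (PosNum e2).
apply: filterS => n; rewrite lt_min => /andP[nh ne].
have n0 : 0 < n.+1%:R^-1 :> R by rewrite invr_gt0.
rewrite sub0r normrN ger0_norm ?Psi_ge0 ?(ltW n0)//.
apply: Psi_le => i; rewrite /tau ge_min; apply/orP; right.
have p1 := pt1_le a i a0; have p2 := pt2_le a n.+1%:R^-1 i a0.
have p12 : normc (g (pt1 a i) - g (pt2 a n.+1%:R^-1 i)) <= e / (2 * (r + 1)).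
  by apply/ltW/hP => //; rewrite (lt_trans _ nh)// pt12_dist.
have q1 : n.+1%:R^-1 * (normc (g (pt1 a i)) + `|y1| + `|y2|) <= e / 2.
  apply: (@le_trans _ _ (e / (2 * (c + 1)) * c)).
    apply: ler_pM; rewrite ?(ltW n0) ?(ltW ne) ?addr_ge0 ?normc_ge0//.
    by rewrite /c !lerD2r BP.
  have -> : e / (2 * (c + 1)) * c = e / 2 * (c / (c + 1)).
    by field; rewrite gt_eqF// ltr_wpDl.
  by rewrite ler_piMr ?divr_ge0 ?(ltW e0)// ler_pdivrMr ?ltr_wpDl//; lra.
have q2 : r * normc (g (pt1 a i) - g (pt2 a n.+1%:R^-1 i)) <= e / 2.
  apply: (@le_trans _ _ (r * (e / (2 * (r + 1))))); first by rewrite ler_wpM2l.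
  have -> : r * (e / (2 * (r + 1))) = e / 2 * (r / (r + 1)).
    by field; rewrite gt_eqF// ltr_wpDl.
  by rewrite ler_piMr ?divr_ge0 ?(ltW e0)// ler_pdivrMr ?ltr_wpDl//; lra.
by rewrite (splitr e) lerD.
Qed.

End tightness_functional.

(** * Expectations *)

Section row_measurability.
Context (R : realType) d (S : measurableType d).

Lemma measurable_floor_eq (f : S -> R) (z : int) : measurable_fun setT f ->
  measurable [set s | Num.floor (f s) = z].
Proof.
move=> mf; rewrite (_ : mkset _ = setT `&` f @^-1` `[z%:~R, (z + 1)%:~R[%classic).
  by apply: mf => //; exact: measurable_itv.
apply/seteqP; split => s /=.
  by move=> <-; split => //; rewrite in_itv/= floor_itv.
by move=> [_]; rewrite in_itv/= => /floor_def.
Qed.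

(** Coordinates are rounded down to the grid of step 1 / (k + 1). The rounded row takes countably
    many values, so preimages are countable unions, and continuity of [f] gives pointwise
    convergence. *)
Lemma measurable_comp_row M (f : 'rV[R]_M -> R) (V : 'I_M -> S -> R) :
  continuous f -> (forall i, measurable_fun setT (V i)) ->
  measurable_fun setT (fun s => f (\row_i V i s)).
Proof.
move=> cf mV.
pose N k i s := Num.floor (k.+1%:R * V i s).
pose h (k : nat) s := f (\row_i ((N k i s)%:~R / k.+1%:R)).
have mh k : measurable_fun setT (h k).
  move=> _ Y mY; rewrite setTI.
  rewrite (_ : _ @^-1` _ = \bigcup_(z : {ffun 'I_M -> int})
      (if `[< Y (f (\row_i ((z i)%:~R / k.+1%:R))) >]
       then \bigcap_(i in setT) [set s | N k i s = z i] else set0)); last first.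
    apply/seteqP; split => s /=.
      move=> Ys; exists [ffun i => N k i s] => //.
      case: asboolP => [_ i _ /=|]; first by rewrite ffunE.
      move=> nY; apply: nY; rewrite (_ : \row_i _ = \row_i ((N k i s)%:~R / k.+1%:R))//.
      by apply/rowP => i; rewrite !mxE ffunE.
    move=> [z _]; case: asboolP => // Yz Nz; rewrite /h.
    rewrite (_ : \row_i _ = \row_i ((z i)%:~R / k.+1%:R))//.
    by apply/rowP => i; rewrite !mxE (Nz i).
  apply: countable_bigcupT_measurable => [|z]; first exact: countableP.
  case: asboolP => // _; apply: fin_bigcap_measurable => // i _.
  by apply: measurable_floor_eq; exact: measurable_funM.
apply: (measurable_fun_cvg mh) => s _.
apply/cvgrPdist_lt => e e0.
pose B := \sum_(i < M) `|V i s|.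
have [r r0 rP] := row_uniform_continuity _ _ f B e cf e0.
have : \forall k \near \oo, k.+1%:R^-1 < r by exact: near_infty_natSinv_lt (PosNum r0).
apply: filterS => k kr; rewrite distrC; apply: rP => i; rewrite !mxE.
  by rewrite /B (bigD1 i)//= lerDl sumr_ge0.
have k0 : 0 < k.+1%:R :> R by [].
apply: le_lt_trans kr; rewrite -[V i s](mulKf (lt0r_neq0 k0)) [_^-1 * (_ * _)]mulrC -mulrBl.
rewrite normrM [`|_^-1|]ger0_norm ?invr_ge0// ler_piMl ?invr_ge0//.
have /andP[] := floor_itv (k.+1%:R * V i s); rewrite -/(N k i s) intrD.
move: (N k i s)%:~R => x; move: (k.+1%:R * V i s) => y h1 h2.
by rewrite ler_norml; apply/andP; split; lra.
Qed.

End row_measurability.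

(** [Psi] samples countably many points; continuity of the empirical path makes its value conclusive
    on the whole interval. *)
Lemma contC_on_Zn (R : realType) (mu sigma a : R) n x : (0 < n)%N ->
  contC_on a (Zn _ mu sigma n x).
Proof.
move=> n0 s sa e e0; rewrite -ler_norml in sa.
pose L := (1 + smean n x ^+ 2 + ssdev n x ^+ 2) + (sigma ^+ 2 * a + 2 * `|mu|).
have a0 : 0 <= a := le_trans (normr_ge0 _) sa.
have L0 : 0 <= L.
  have := mulr_ge0 (sqr_ge0 sigma) a0; have := sqr_ge0 (smean n x).
  have := sqr_ge0 (ssdev n x); have := normr_ge0 mu; rewrite /L; lra.
have n1 := sqrtn_gt0 R n n0.
have LS : 0 < Num.sqrt n%:R * (L + 1) by rewrite mulr_gt0// ltr_wpDl.
exists (e / (Num.sqrt n%:R * (L + 1))); first by rewrite divr_gt0.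
move=> s' s'a; rewrite -ler_norml in s'a; rewrite ltr_pdivlMr// => ss'.
rewrite sqrt_normsq /Zn -mulrBr normcM normc_RtoC (ger0_norm (ltW n1)).
have -> : ecf n x s' - psi mu sigma s' - (ecf n x s - psi mu sigma s)
  = (ecf n x s' - ecf n x s) - (psi mu sigma s' - psi mu sigma s) by ring.
apply: le_lt_trans ss'; rewrite [leRHS]mulrC -mulrA ler_wpM2l ?(ltW n1)//.
rewrite (le_trans (le_normcB _ _ _))//.
have := ecf_lipschitz _ n x s' s n0; have := psi_lipschitz _ mu sigma a s' s s'a sa.
have := normr_ge0 (s' - s); rewrite /L; lra.
Qed.

(** * Expectations of bounded random variables *)

Section bounded_expectation.
Context d (S : measurableType d) (R : realType) (P : probability S R).
Implicit Types (h : S -> R) (C : R).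

Lemma integrable_bounded_prob h C : measurable_fun setT h ->
  (forall s, `|h s| <= C) -> P.-integrable setT (EFin \o h).
Proof.
move=> mh hC; apply: measurable_bounded_integrable => //.
  by rewrite [X in (X < _)%E](@probability_setT _ _ _ P) ltry.
exists C; split; first exact: num_real.
by move=> M CM s _ /=; rewrite (le_trans (hC s))// ltW.
Qed.

Lemma EFin_expectation h C : measurable_fun setT h -> (forall s, `|h s| <= C) ->
  (\int[P]_s (h s)%:E)%E = ((\int[P]_s h s)%R)%:E.
Proof.
move=> mh hC; rewrite fineK//; apply: integrable_fin_num => //.
exact: integrable_bounded_prob hC.
Qed.

End bounded_expectation.

(** Slutsky's argument at the level of expectations: closeness in mean transfers the limit from [B]
    to [A]. *)
Lemma cvg_expectation_dist (R : realType) d (S : measurableType d)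
    (P : probability S R) (A B : nat -> S -> R) (C l : R) :
  (forall n, measurable_fun setT (A n)) -> (forall n, measurable_fun setT (B n)) ->
  (forall n s, `|A n s| <= C) -> (forall n s, `|B n s| <= C) ->
  (\int[P]_s (B n s)%:E)%E @[n --> \oo] --> l%:E ->
  (forall e, 0 < e -> \forall n \near \oo, (\int[P]_s `|A n s - B n s|)%R < e) ->
  (\int[P]_s (A n s)%:E)%E @[n --> \oo] --> l%:E.
Proof.
move=> mA mB AC BC Bl AB.
have -> : (fun n => \int[P]_s (A n s)%:E)%E = (fun n => ((\int[P]_s A n s)%R)%:E).
  by apply/funext => n; rewrite (EFin_expectation _ _ _ _ _ C).
have Bl' : (\int[P]_s B n s)%R @[n --> \oo] --> l by exact: fine_cvg Bl.
apply: cvg_EFin; first by near=> n.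
apply/cvgrPdist_lt => e e0; have e2 : 0 < e / 2 by rewrite divr_gt0.
have /cvgrPdist_lt/(_ _ e2) near1 := Bl'; have near2 := AB _ e2.
near=> n.
have h1 : `|l - (\int[P]_s B n s)%R| < e / 2 by near: n.
have h2 : (\int[P]_s `|A n s - B n s|)%R < e / 2 by near: n.
have iA := integrable_bounded_prob _ _ _ P (A n) C (mA n) (AC n).
have iB := integrable_bounded_prob _ _ _ P (B n) C (mB n) (BC n).
have iAB : P.-integrable setT (EFin \o (fun s => A n s - B n s)).
  by apply: (integrable_bounded_prob _ _ _ P _ (C + C)) => [|s];
    [exact: measurable_funB|rewrite (le_trans (ler_normB _ _))// lerD].
have h3 : `|(\int[P]_s A n s)%R - (\int[P]_s B n s)%R| < e / 2.
  by rewrite -RintegralB//; apply: le_lt_trans h2; exact: le_normr_Rintegral.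
rewrite (splitr e) /= -(subrKA (\int[P]_s B n s)%R) (le_lt_trans (ler_normD _ _))// ltrD//.
by rewrite distrC.
Unshelve. all: by end_near.
Qed.

(** * The limit theorem *)

Lemma row_Qm_bdd_cont (R : realType) (mu sigma T beta : R) M (f : 'rV[R]_M -> R) :
  0 < sigma -> 0 <= T -> 0 <= beta -> continuous f ->
  (exists C : R, forall v, `|f v| <= C) ->
  let w := fun t : R => expR (- (beta * t ^+ 2)) in
  bdd_cont_functional (T / sigma)
    (fun g y1 y2 => f (\row_(i < M) Qm w T mu sigma g y1 y2 i.+1)).
Proof.
move=> s0 T0 beta0 cf [C fC] w; split; first by exists C => g y1 y2.
move=> g y1 y2 e e0.
pose v := \row_(i < M) Qm w T mu sigma g y1 y2 i.+1.
have [r r0 rP] := row_uniform_continuity _ _ f (\sum_(i < M) `|v ord0 i|) e cf e0.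
have /choice[dd ddP] : forall i : nat, exists d : R, 0 < d /\ forall g' y1' y2',
    (forall s, `|s| <= T / sigma -> normc (g' s - g s) < d) ->
    `|y1' - y1| < d -> `|y2' - y2| < d ->
    `|Qm w T mu sigma g' y1' y2' i.+1 - Qm w T mu sigma g y1 y2 i.+1| < r.
  by move=> i; have [d] := Qm_continuous _ mu sigma T beta i g y1 y2 s0 T0 beta0 r r0; exists d.
(* The initial value 1 keeps the minimum positive when M = 0. *)
exists (\big[Num.min/1]_(i < M) dd i).
  by apply: lt_bigmin => // i _; have [] := ddP i.
move=> g' y1' y2' gg h1 h2; apply: rP => i.
  by rewrite (bigD1 i)//= lerDl sumr_ge0.
have le_dd : \big[Num.min/1]_(i < M) dd i <= dd i by exact: bigmin_le_cond.
rewrite !mxE; apply: (ddP i).2.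
- by move=> s; rewrite ler_norml -sqrt_normsq => /gg h; exact: lt_le_trans le_dd.
- exact: lt_le_trans le_dd.
- exact: lt_le_trans le_dd.
Qed.

Lemma natSinv_small (R : realType) (e : R) : 0 < e ->
  \forall n \near \oo, (0 < n)%N /\ (Num.sqrt n%:R)^-1 < e.
Proof.
move=> e0; have e2 : 0 < e ^+ 2 by rewrite exprn_gt0.
have [N _ NP] := near_infty_natSinv_lt (PosNum e2).
exists N.+1 => //= -[//|n] /= Nn; split => //.
have n0 : 0 < n.+1%:R :> R by [].
rewrite invf_plt ?posrE ?sqrtr_gt0// -[e^-1]ger0_norm ?invr_ge0 ?(ltW e0)// -sqrtr_sqr.
rewrite ltr_sqrt// exprVn invf_plt ?posrE//.
exact: (NP n).
Qed.

(** Tightness of the limit law, by dominated convergence along its continuous paths. *)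
Lemma Psi_expectation_small (R : realType) d' (Omega' : measurableType d')
  (P' : probability Omega' R) (G : Omega' -> R -> R[i]) (Y1 Y2 : Omega' -> R) (a r e : R) :
  0 <= a -> 0 <= r -> (forall w, contC_on a (G w)) ->
  (forall F, bdd_cont_functional a F ->
     measurable_fun setT (fun w => F (G w) (Y1 w) (Y2 w))) -> 0 < e ->
  exists k : nat, (\int[P']_w Psi _ a k.+1%:R^-1 r k.+1%:R^-1 (G w) (Y1 w) (Y2 w))%R < e.
Proof.
move=> a0 r0 cG mG e0.
pose h k w := Psi _ a k.+1%:R^-1 r k.+1%:R^-1 (G w) (Y1 w) (Y2 w).
have kp (k : nat) : 0 < k.+1%:R^-1 :> R by rewrite invr_gt0.
have mh k : measurable_fun setT (h k).
  by apply: mG; apply: Psi_bdd_cont => //; exact: ltW.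
have h1 k w : `|h k w| <= 1.
  rewrite ger0_norm ?Psi_ge0 ?(ltW (kp k))//; exact: Psi_le1.
have cvh : (\int[P']_w (h k w)%:E)%E @[k --> \oo] --> (\int[P']_w (cst 0%E) w)%E.
  apply: (dominated_cvg measurableT (g := cst 1%E)) => //.
  - by move=> k; exact/measurable_EFinP.
  - by move=> w _; apply: cvg_EFin; [exact: nearW|exact: Psi_cvg0].
  - apply: (integrable_bounded_prob _ _ _ P' (cst 1) 1); first exact: measurable_cst.
    by move=> w /=; rewrite normr1.
  - by move=> k w _; rewrite /= lee_fin.
rewrite integral0 in cvh.
have /cvgrPdist_lt/(_ _ e0) : (\int[P']_w h k w)%R @[k --> \oo] --> (0 : R).
  exact: fine_cvg cvh.
move=> /filter_ex[k]; rewrite sub0r normrN => hk; exists k.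
exact: le_lt_trans (ler_norm _) hk.
Qed.
Theorem theorem2 (R : realType)
  (d : measure_display) (Omega : measurableType d) (P : probability Omega R)
  (mu sigma : R) (X : nat -> Omega -> R)
  (d' : measure_display) (Omega' : measurableType d') (P' : probability Omega' R)
  (G : Omega' -> R -> R[i]) (Y1 Y2 : Omega' -> R)
  (T : R) (M : nat) (beta : R) :
  0 < sigma ->
  (* X_1, X_2, ... i.i.d. N(mu, sigma^2) *)
  (forall k, measurable_fun setT (X k)) ->
  mutually_independent P X ->
  (forall k (B : set R), measurable B ->
     P (X k @^-1` B) = normal_prob mu sigma B) ->
  0 < T -> 0 < beta ->
  (* (G, Y1, Y2) is a random element of C([-T/sigma, T/sigma]; C) x R^2 ... *)
  (forall w', contC_on (T / sigma) (G w')) ->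
  (forall F, bdd_cont_functional (T / sigma) F ->
     measurable_fun setT (fun w' => F (G w') (Y1 w') (Y2 w'))) ->
  (* ... which is the joint weak limit of
     (sqrt n (ecf - psi), sqrt n (Xbar - mu), sqrt n (S_X - sigma)) *)
  (forall F, bdd_cont_functional (T / sigma) F ->
     (fun n : nat => \int[P]_w
        (F (fun s => RtoC (Num.sqrt n%:R) *
                       (ecf n (fun k => X k w) s - psi mu sigma s))
           (Num.sqrt n%:R * (smean n (fun k => X k w) - mu))
           (Num.sqrt n%:R * (ssdev n (fun k => X k w) - sigma)))%:E)%E
       @ \oo --> (\int[P']_w' (F (G w') (Y1 w') (Y2 w'))%:E)%E) ->
  (* conclusion: n (Delta_1, ..., Delta_M) -d-> (Q_1, ..., Q_M) *)
  let wt := fun t : R => expR (- (beta * t ^+ 2)) in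
  forall f : 'rV[R]_M -> R, continuous f ->
    (exists C : R, forall v, `|f v| <= C) ->
    (fun n : nat => \int[P]_w
        (f (\row_(i < M) (n%:R * Delta wt T n (fun k => X k w) i.+1)))%:E)%E
      @ \oo -->
    (\int[P']_w' (f (\row_(i < M) Qm wt T mu sigma (G w') (Y1 w') (Y2 w') i.+1))%:E)%E.
Proof.
move=> s0 mX _ _ T0 beta0 cG mG wcv wt f cf fC.
have a0 : 0 <= T / sigma by rewrite divr_ge0 ?ltW.
set a := T / sigma in a0 cG mG wcv.
pose Z n w := Zn _ mu sigma n (fun k => X k w).
pose U n w := Un _ mu n (fun k => X k w).
pose V n w := Vn _ sigma n (fun k => X k w).
pose Fc (g : R -> R[i]) (y1 y2 : R) := f (\row_(i < M) Qm wt T mu sigma g y1 y2 i.+1).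
have Fc_cont : bdd_cont_functional a Fc.
  by apply: row_Qm_bdd_cont => //; exact: ltW.
have [C0 fC0] := fC; pose C := `|C0| + 1.
have C1 : 0 < C by rewrite ltr_wpDl.
have {fC0}fC1 v : `|f v| <= C.
  by rewrite (le_trans (fC0 v))// (le_trans (ler_norm _))// lerDl.
have mU n : measurable_fun setT (U n).
  by apply: measurable_funM => //; apply: measurable_funB => //; exact: measurable_smean.
have mV n : measurable_fun setT (V n).
  by apply: measurable_funM => //; apply: measurable_funB => //; exact: measurable_ssdev.
have mw dd (S : measurableType dd) (h : S -> R) : measurable_fun setT h ->
    measurable_fun setT (fun s => wt (h s)).
  exact: measurable_expRN_sqr.
have mX1 k : measurable_fun setT (fun p : Omega * R => X k p.1).
  exact: measurableT_comp (mX k) measurable_fst.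
have m2 : measurable_fun setT (fun p : Omega * R => p.2) by exact: measurable_snd.
pose A n w := f (\row_(i < M) (n%:R * Delta wt T n (fun k => X k w) i.+1)).
pose B n w := Fc (Z n w) (U n w) (V n w).
have mA n : measurable_fun setT (A n).
  apply: (measurable_comp_row _ _ _ M f
    (fun i w => n%:R * Delta wt T n (fun k => X k w) i.+1)) => // i.
  apply: measurable_funM => //.
  apply: (measurable_Rintegral_param _ _ _ T
    (fun w t => wt t * normsq (Dm n (fun k => X k w) i.+1 t))) => [|w t].
    apply: measurable_funM; first exact: mw.
    apply: measurable_normsq.
    exact: (measurableC_Dm _ _ _ n (fun k (p : Omega * R) => X k p.1)).
  by rewrite mulr_ge0 ?normsq_ge0 ?expR_ge0.
have mB n : measurable_fun setT (B n).
  apply: (measurable_comp_row _ _ _ M f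
    (fun i w => Qm wt T mu sigma (Z n w) (U n w) (V n w) i.+1)) => // i.
  apply: (measurable_Rintegral_param _ _ _ T (fun w t => wt t * psi0 t ^+ 2 *
      normsq (Hm mu sigma (Z n w) (U n w) (V n w) i.+1 t))) => [|w t].
    apply: measurable_funM.
      apply: measurable_funM; first exact: mw.
      by apply: measurable_funX; exact: measurable_psi0.
    apply: measurable_normsq.
    apply: (measurableC_Hm _ _ _ mu sigma (fun p : Omega * R => Z n p.1)
      (fun p => U n p.1) (fun p => V n p.1)) => //.
    - by move=> h mh; exact: (measurableC_Zn _ _ _ mu sigma n (fun k (p : Omega * R) => X k p.1)).
    - exact: measurableT_comp (mU n) measurable_fst.
    - exact: measurableT_comp (mV n) measurable_fst.
  by rewrite !mulr_ge0 ?normsq_ge0 ?expR_ge0 ?sqr_ge0.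
have mFG : measurable_fun setT (fun w' => Fc (G w') (Y1 w') (Y2 w')) by exact: mG.
have BL := wcv _ Fc_cont.
rewrite (EFin_expectation _ _ _ P' _ C mFG (fun=> fC1 _)) in BL.
rewrite (EFin_expectation _ _ _ P' _ C mFG (fun=> fC1 _)).
apply: (cvg_expectation_dist _ _ _ P A B C) => //; try by move=> *; exact: fC1.
have mPsi n k r : 0 <= r -> measurable_fun setT
    (fun w => Psi _ a k.+1%:R^-1 r k.+1%:R^-1 (Z n w) (U n w) (V n w)).
  move=> r0; apply: measurable_Psi => //; rewrite ?invr_ge0// => s.
  exact: (measurableC_Zn _ _ _ mu sigma n X).
have Psi1 (k : nat) r g y1 y2 : 0 <= r -> `|Psi R a k.+1%:R^-1 r k.+1%:R^-1 g y1 y2| <= 1.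
  by move=> r0; rewrite ger0_norm ?Psi_ge0 ?Psi_le1 ?invr_ge0.
(* [Psi] is itself an admissible test functional, so its small expectation under the limit passes to
   all large n. *)
have tight r e : 0 <= r -> 0 < e -> exists k : nat, \forall n \near \oo,
    (\int[P]_w Psi _ a k.+1%:R^-1 r k.+1%:R^-1 (Z n w) (U n w) (V n w))%R < e.
  move=> r0 e0; have [k kP] := Psi_expectation_small _ _ _ P' G Y1 Y2 a r e a0 r0 cG mG e0.
  exists k; have Pc : bdd_cont_functional a (Psi _ a k.+1%:R^-1 r k.+1%:R^-1).
    by apply: Psi_bdd_cont; rewrite // ?invr_ge0.
  have := wcv _ Pc.
  rewrite (EFin_expectation _ _ _ P' _ 1 (mG _ Pc)); last by move=> w; exact: Psi1.
  move=> /fine_cvg /cvgr_lt; exact.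
move=> e e0.
(* Makes the final bound e / 4 + 2 C (e1 + e1) equal to 3 e / 4. *)
pose e1 := e / (8 * C).
have e10 : 0 < e1 by rewrite divr_gt0// mulr_gt0.
have small x y : x < e1 -> y < e1 -> e / 4 + 2 * C * (x + y) < e.
  move=> xe ye; apply: (@le_lt_trans _ _ (e / 4 + 2 * C * (e1 + e1))).
    by rewrite lerD2l ler_wpM2l ?mulr_ge0 ?(ltW C1)// lerD// ltW.
  rewrite (_ : 2 * C * (e1 + e1) = e / 2); last by rewrite /e1; field; rewrite gt_eqF.
  by lra.
(* The order of choices matters: r = 0 tests size only and fixes [K], which determines [D], then
   [eta]; the scale of oscillation is chosen after that, by a second use of [tight]. *)
have [k1 tight1] := tight 0 e1 (lexx _) e10.
pose K : R := k1.+1%:R.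
have [D D0 DP] : exists2 D : R, 0 < D & forall i : 'I_M, forall n x eta delta, (0 < n)%N ->
    let h := (Num.sqrt n%:R)^-1 in
    h <= 1 -> h * K <= sigma / 2 -> D * h < delta -> 0 <= eta <= 1 ->
    tame _ a K eta delta (Zn _ mu sigma n x) (Un _ mu n x) (Vn _ sigma n x) ->
    let Q := Qm wt T mu sigma (Zn _ mu sigma n x) (Un _ mu n x) (Vn _ sigma n x) i.+1 in
    `|n%:R * Delta wt T n x i.+1 - Q| <= D * (h + eta) /\ `|Q| <= D.
  have /choice[c cP] : forall i : nat, exists c : R, 0 <= c /\ forall n x eta delta, (0 < n)%N ->
    let h := (Num.sqrt n%:R)^-1 in
    h <= 1 -> h * K <= sigma / 2 -> c * h < delta -> 0 <= eta <= 1 ->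
    tame _ a K eta delta (Zn _ mu sigma n x) (Un _ mu n x) (Vn _ sigma n x) ->
    let Q := Qm wt T mu sigma (Zn _ mu sigma n x) (Un _ mu n x) (Vn _ sigma n x) i.+1 in
    `|n%:R * Delta wt T n x i.+1 - Q| <= c * (h + eta) /\ `|Q| <= c.
    move=> i; have [c] := nDelta_Qm_dist _ mu sigma T K beta i s0 (ltW T0) (ler0n _ _) (ltW beta0).
    by exists c.
  (* A sum serves all indices at once, and the 1 keeps [D] positive for the divisions below. *)
  exists (1 + \sum_(i < M) c i).
    by rewrite ltr_pwDl// sumr_ge0// => i _; have [] := cP i.
  move=> i n x eta delta n0 /= h1 hK hd eta01 tm.
  have cD : c i <= 1 + \sum_(i < M) c i.
    rewrite (bigD1 i)//= addrCA lerDl addr_ge0// sumr_ge0// => j _.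
    by have [] := cP j.
  have [_ /(_ n x eta delta n0 h1 hK)] := cP i.
  case=> //; first by apply: le_lt_trans hd; rewrite ler_wpM2r// invr_ge0 sqrtr_ge0.
  move=> d1 d2; split; last exact: le_trans cD.
  rewrite (le_trans d1)// ler_wpM2r// addr_ge0// ?invr_ge0 ?sqrtr_ge0//.
  by case/andP: eta01.
have e4 : 0 < e / 4 by rewrite divr_gt0.
(* On the tame event the Q_m lie in the box of radius [D]. *)
have [r r0 rP] := row_uniform_continuity _ _ f D (e / 4) cf e4.
have r4 : r / 4 + r / 4 <= r by lra.
pose eta := Num.min 1 (r / 4 / D).
have eta0 : 0 < eta by rewrite lt_min ltr01 !divr_gt0.
have eta1 : eta <= 1 by rewrite ge_min lexx.
have etar : D * eta <= r / 4.
  by rewrite mulrC -ler_pdivlMr// ge_min lexx orbT.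
have ietaP : 0 <= eta^-1 by rewrite invr_ge0 ltW.
have [k2 tight2] := tight eta^-1 e1 ietaP e10.
(* Encodes h <= 1, h K <= sigma / 2, D h < 1 / (k2 + 1) and D h < r / 4. *)
pose h0 := Num.min 1 (Num.min (sigma / 2 / K) (Num.min (k2.+1%:R^-1 / D) (r / 4 / D))).
have h00 : 0 < h0 by rewrite !lt_min ltr01 !divr_gt0.
apply: filterS3 (natSinv_small _ _ h00) tight1 tight2 => n [n0 hn] t1 t2.
move: hn; rewrite !lt_min => /and4P[/ltW hn1 hn2 hn3 hn4].
rewrite ltr_pdivlMr// in hn2; rewrite ltr_pdivlMr// mulrC in hn3.
rewrite ltr_pdivlMr// mulrC in hn4.
set p1 := fun w => Psi _ a k1.+1%:R^-1 0 k1.+1%:R^-1 (Z n w) (U n w) (V n w).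
set p2 := fun w => Psi _ a k2.+1%:R^-1 eta^-1 k2.+1%:R^-1 (Z n w) (U n w) (V n w).
have p10 w : 0 <= p1 w by rewrite Psi_ge0 ?invr_ge0.
have p20 w : 0 <= p2 w by apply: Psi_ge0; rewrite // invr_ge0.
(* Markov's inequality in pointwise form: where p1 + p2 >= 1 the trivial bound 2 C suffices, and
   elsewhere both are below 1 and the path is tame. *)
have AB w : `|A n w - B n w| <= e / 4 + (2 * C) * (p1 w + p2 w).
  have [q1|q1] := leP 1 (p1 w + p2 w).
    rewrite (le_trans (ler_normB _ _))// (le_trans (lerD (fC1 _) (fC1 _)))//.
    rewrite (_ : C + C = 2 * C); last by ring.
    by rewrite ler_wpDl ?(ltW e4)// ler_peMr// mulr_ge0// ltW.
  have lt1 : p1 w < 1 by apply: le_lt_trans q1; rewrite lerDl.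
  have lt2 : p2 w < 1 by apply: le_lt_trans q1; rewrite lerDr.
  have cZ : contC_on a (Z n w) by exact: contC_on_Zn.
  have KV : 0 < K by [].
  have k1p : 0 < k1.+1%:R^-1 :> R by rewrite invr_gt0.
  have k2p : 0 < k2.+1%:R^-1 :> R by rewrite invr_gt0.
  have [b1 b2 b3 _] := Psi_lt1 _ _ _ _ _ a0 (ltW k1p) (lexx 0) k1p _ _ _ cZ lt1.
  have [_ _ _ b4] := Psi_lt1 _ _ _ _ _ a0 (ltW k2p) ietaP k2p _ _ _ cZ lt2.
  have tm : tame _ a K eta k2.+1%:R^-1 (Z n w) (U n w) (V n w).
    split.
    - by rewrite -[leRHS]mulr1 -ler_pdivrMl.
    - by rewrite -[leRHS]mulr1 -ler_pdivrMl.
    - by move=> s sa; rewrite -[leRHS]mulr1 -ler_pdivrMl// b3.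
    - by move=> s s' sa s'a ss'; rewrite -[leRHS]mulr1 -ler_pdivrMl// b4.
  have eta01 : 0 <= eta <= 1 by rewrite ltW.
  have dist := DP _ n (fun k => X k w) eta _ n0 hn1 (ltW hn2) hn3 eta01 tm.
  rewrite (@le_trans _ _ (e / 4))//; last first.
    by rewrite lerDl mulr_ge0 ?addr_ge0 ?mulr_ge0 ?(ltW C1).
  apply/ltW/rP => i; rewrite !mxE; have [d1 d2] := dist i => //.
  apply: (le_lt_trans d1); rewrite mulrDr.
  exact: lt_le_trans (ltr_leD hn4 etar) r4.
have mp1 : measurable_fun setT p1 by exact: (mPsi n k1 0 (lexx _)).
have mp2 : measurable_fun setT p2 by exact: (mPsi n k2 _ ietaP).
have ip1 : P.-integrable setT (EFin \o p1).
  by apply: (integrable_bounded_prob _ _ _ P _ 1) => // w; exact: Psi1.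
have ip2 : P.-integrable setT (EFin \o p2).
  by apply: (integrable_bounded_prob _ _ _ P _ 1) => // w; exact: Psi1.
have ip12 : P.-integrable setT (EFin \o (fun w => p1 w + p2 w)).
  apply: (integrable_bounded_prob _ _ _ P _ (1 + 1)); first exact: measurable_funD.
  by move=> w; rewrite (le_trans (ler_normD _ _))// lerD// Psi1.
have iC : P.-integrable setT (EFin \o (fun w => 2 * C * (p1 w + p2 w))).
  exact: (integrableZl measurableT (2 * C) ip12).
have ie : P.-integrable setT (EFin \o (fun _ : Omega => e / 4)).
  exact: (integrable_bounded_prob _ _ _ P _ `|e / 4|).
apply: (@le_lt_trans _ _ (\int[P]_w (e / 4 + 2 * C * (p1 w + p2 w)))%R).
  apply: le_Rintegral => //.
    apply: (integrable_bounded_prob _ _ _ P _ (C + C)).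
      by apply: measurableT_comp => //; exact: measurable_funB.
    by move=> w; rewrite normr_id (le_trans (ler_normB _ _))// lerD; rewrite ?fC1.
  exact: (integrableD measurableT ie iC).
have -> := RintegralD measurableT ie iC.
have -> := RintegralZl (2 * C) measurableT ip12.
have -> := RintegralD measurableT ip1 ip2.
rewrite Rintegral_cst//.
rewrite [X in fine X](@probability_setT _ _ _ P) mulr1.
exact: small t1 t2.
Qed.
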